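(* Let $w$ be a weight vector for $H_A(\beta)$ and let $\beta_0\in\mathbb{C}$ be a homogenizing value for $A$, $\beta$, and $w$. Then $\rho(\mathscr{S}_w(H_A(\beta)))$ equals the $\mathbb{C}$-linear span of the logarithm-free basic Nilsson solutions of $H_{\rho(A)}(\beta_0,\beta)$ in the direction of $(0,w)$ which are associated to standard pairs of $\mathrm{in}_{(0,w)}(I_{\rho(A)})$ that pass through zero.
   Context: Hypergeometric systems. $\mathbb{N}=\{0,1,2,\dots\}$. $A=[a_{ij}]\in\mathbb{Z}^{d\times n}$ is a matrix whose columns $a_1,\dots,a_n$ generate $\mathbb{Z}^d$ as a group, and $\beta\in\mathbb{C}^d$ (arbitrary). $D$ is the complex Weyl algebra in $x_1,\dots,x_n,\partial_1,\dots,\partial_n$; $I_A=\langle \partial^u-\partial^v\mid u,v\in\mathbb{N}^n,\ Au=Av\rangle\subseteq\mathbb{C}[\partial_1,\dots,\partial_n]$; $E_i=\sum_{j}a_{ij}x_j\partial_j$; $\langle E-\beta\rangle=\langle E_1-\beta_1,\dots,E_d-\beta_d\rangle$; $H_A(\beta)=D\cdot I_A+\langle E-\beta\rangle$. $\ker_{\mathbb{Z}}(A)=\{u\in\mathbb{Z}^n: Au=0\}$, and $|u|$ is the sum of the coordinates of $u$. Weight vectors. For $w\in\mathbb{R}^n$, the $(-w,w)$-weight of $x^u\partial^v$ is $-w\cdot u+w\cdot v$; the initial form of a nonzero $f\in D$ is the sum of its terms of maximal weight; $\mathrm{in}_{(-w,w)}(J)$ is the left ideal generated by the initial forms of nonzero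 elements of a left ideal $J$. Similarly $\mathrm{in}_w(J)$ for an ideal $J\subseteq\mathbb{C}[\partial]$, where $\partial^v$ has weight $w\cdot v$. A vector $w\in\mathbb{R}^n_{>0}$ is a weight vector for $H_A(\beta)$ if there is a strongly convex open rational polyhedral cone $\mathscr{C}\subset\mathbb{R}^n_{>0}$ containing $w$ such that for all $w'\in\mathscr{C}$: $\mathrm{in}_w(I_A)=\mathrm{in}_{w'}(I_A)$ and $\mathrm{in}_{(-w,w)}(H_A(\beta))=\mathrm{in}_{(-w',w')}(H_A(\beta))$. Then $\mathrm{in}_w(I_A)$ is a monomial ideal. When $(1,\dots,1)$ lies in the rational row span of the matrix, the positivity requirements are dropped. $\mathscr{C}^*=\{u\in\mathbb{R}^n: u\cdot w'\ge 0\ \forall w'\in\mathscr{C}\}$. Series. A basic Nilsson solution of $H_A(\beta)$ in the direction of $w$ is a formal solution of $H_A(\beta)$ of the form $\phi=\sum_{u\in C}x^{v+u}p_u(\log x_1,\dots,\log x_n)$, with $v\in\mathbb{C}^n$, such that: (1) $C\subseteq\mathscr{C}^*\cap\ker_{\mathbb{Z}}(A)$ for some strongly convex open rational polyhedral cone $\mathscr{C}\ni w$ (contained in $\mathbb{R}^n_{>0}$ unless $(1,\dots,1)$ lies in the rational row span of the matrix) such that $\mathrm{in}_w(I_A)=\mathrm{in}_{w'}(I_A)$ and $\mathrm{in}_{(-w,w)}(H_A(\beta))=\mathrm{in}_{(-w',w')}(H_A(\beta))$ for all $w'\in\mathscr{C}$; (2) the $p_u$ are polynomials with degrees bounded by a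 common integer; (3) $p_0\neq0$. It is logarithm-free if all $p_u$ are constants. $\mathscr{S}_w(H_A(\beta))$ is the $\mathbb{C}$-vector space of logarithm-free formal series solutions of $H_A(\beta)$ in the direction of $w$, i.e. the space spanned by formal solutions of $H_A(\beta)$ of the form $\sum_{u\in C}\lambda_ux^{v+u}$, with $v\in\mathbb{C}^n$, constants $\lambda_u\in\mathbb{C}$, and $C$ satisfying (1); it has a basis consisting of logarithm-free basic Nilsson solutions in the direction of $w$. Standard pairs. A standard pair of a monomial ideal $I\subseteq\mathbb{C}[\partial_1,\dots,\partial_n]$ is a pair $(\partial^\alpha,\sigma)$ with $\alpha\in\mathbb{N}^n$, $\sigma\subseteq\{1,\dots,n\}$, such that $\alpha+\mathbb{C}^\sigma$ is an irreducible component of the Zariski closure of $\{u\in\mathbb{N}^n:\partial^u\notin I\}$ and $\alpha$ is the coordinatewise minimal element of $(\alpha+\mathbb{C}^\sigma)\cap\mathbb{N}^n$, where $\mathbb{C}^\sigma=\{t: t_i=0\text{ for }i\notin\sigma\}$. A fake exponent of $H_A(\beta)$ with respect to $w$ is $v\in\mathbb{C}^n$ such that $x^v$ is a solution of $\mathrm{in}_w(I_A)+\langle E-\beta\rangle$; equivalently $Av=\beta$ and $v_i=\alpha_i$ for all $i\notin\sigma$, for some standard pair $(\partial^\alpha,\sigma)$ of $\mathrm{in}_w(I_A)$ (to which $v$ then corresponds). A basic Nilsson solution $\sum_{u\in C}x^{v+u}p_u(\log(x))$ is associated to a standard pair if $v$ is the fake exponent corresponding to it. Homogenization. $\rho(A)\in\mathbb{Z}^{(d+1)\times(n+1)}$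 is obtained from $A$ by attaching a column of zeros on the left and then a top row of ones; its columns, and the corresponding variables $x_0,\dots,x_n$, are indexed by $0,\dots,n$. All notions above apply to $\rho(A)$, $(\beta_0,\beta)$, $(0,w)$. A standard pair $(\partial^\alpha,\sigma)$ of $\mathrm{in}_{(0,w)}(I_{\rho(A)})$ passes through zero if $0\in\sigma$. $\beta_0$ is a homogenizing value for $A,\beta,w$ if $\beta_0\notin\mathbb{Z}$ and $\beta_0-|v|\notin\mathbb{Z}$ for every fake exponent $v$ of $H_A(\beta)$ with respect to $w$. Standing assumption: $(0,w)$ is a weight vector for $H_{\rho(A)}(\beta_0,\beta)$. For a logarithm-free basic Nilsson solution $\phi=\sum_{u\in C}\lambda_ux^{v+u}$ of $H_A(\beta)$ in the direction of $w$, its homogenization is $\rho(\phi)=\sum_{u\in C}\lambda_u\,\partial_0^{|u|}\bigl[x_0^{\beta_0-|v|}\bigr]x^{v+u}$, where for $s_0\notin\mathbb{Z}$ one sets $\partial_0^{-1}[x_0^{s_0}]=x_0^{s_0+1}/(s_0+1)$ and iterates to define $\partial_0^{-k}$, $k>0$. On $\mathscr{S}_w(H_A(\beta))$, $\rho$ is the linear extension of this assignment from a basis of $\mathscr{S}_w(H_A(\beta))$ consisting of logarithm-free basic Nilsson solutions. *)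

(* Defs.v *)
From HB Require Import structures.
From mathcomp Require Import all_boot all_order all_algebra.
From mathcomp Require Import boolp classical_sets functions reals.
From mathcomp.real_closed Require Import complex.
From mathcomp.multinomials Require Import mpoly.
From mathcomp Require Import ring.
Set Implicit Arguments.
Unset Strict Implicit.
Unset Printing Implicit Defensive.
Import Order.TTheory GRing.Theory Num.Theory.
Local Open Scope classical_set_scope.
Local Open Scope ring_scope.

Section LinearExtension.
Variables (F : comNzRingType) (k : nat) (V : lmodType F) (g : 'X_{1..k} -> V).

Definition mlin (p : {mpoly F[k]}) : V := \sum_(m <- msupp p) p@_m *: g m.

Lemma mlin_sub (s : seq 'X_{1..k}) p :
  uniq s -> {subset msupp p <= s} -> mlin p = \sum_(m <- s) p@_m *: g m.
Proof.
move=> us sps; rewrite /mlin [RHS](bigID (mem (msupp p))) /=.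
rewrite [X in _ + X]big1 ?addr0 => [|m /memN_msupp_eq0 ->]; last by rewrite scale0r.
rewrite -[RHS]big_filter; apply: perm_big; apply: uniq_perm; rewrite ?filter_uniq ?msupp_uniq //.
by move=> m; rewrite mem_filter; case: (boolP (m \in msupp p)) => // /sps ->.
Qed.

Lemma mlin_is_linear : linear mlin.
Proof.
move=> c p q.
pose s := undup (msupp p ++ msupp q ++ msupp (c *: p + q)).
have sub r : {subset msupp r <= msupp p ++ msupp q ++ msupp (c *: p + q)} ->
    mlin r = \sum_(m <- s) r@_m *: g m.
  by move=> h; apply: mlin_sub; [exact: undup_uniq | move=> m /h; rewrite mem_undup].
rewrite !sub; try by move=> m; rewrite !mem_cat => ->; rewrite ?orbT.
rewrite scaler_sumr -big_split /=; apply: eq_bigr => m _.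
by rewrite mcoeffD mcoeffZ scalerDl scalerA.
Qed.

HB.instance Definition _ :=
  GRing.isLinear.Build F {mpoly F[k]} V *:%R mlin mlin_is_linear.

Lemma mlinX m : mlin 'X_[m] = g m.
Proof. by rewrite /mlin msuppX big_seq1 mcoeffX eqxx scale1r. Qed.

End LinearExtension.

Lemma mlin_ext (F : comNzRingType) k (V : lmodType F) (f : {mpoly F[k]} -> V)
    (h : {mpoly F[k]} -> V) :
  linear f -> linear h -> (forall m, f 'X_[m] = h 'X_[m]) -> f =1 h.
Proof.
move=> lf lh e p; have z g : linear g -> g 0 = 0 :> V.
  by move=> lg; have := lg (-1) 0 0; rewrite scaler0 add0r scaleN1r addNr.
rewrite (mpolyE p); elim: (msupp p) => [|m s IH]; first by rewrite !big_nil !z.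
by rewrite !big_cons lf lh e IH.
Qed.

(* The product of the Weyl algebra on normally ordered expressions: [dmul i]
   is left multiplication by the i-th derivation, d_i q = q d_i + dq/dx_i. *)
Section WeylProduct.
Variables (F : comNzRingType) (n : nat).
Local Notation P := {mpoly F[n + n]}.
Implicit Types (p q r : P) (m : 'X_{1..n + n}) (i : 'I_n).

Definition xpart m : 'X_{1..n + n} :=
  [multinom (if fintype.split j is inl _ then m j else 0%N) | j < n + n].
Definition xmon m : P := 'X_[xpart m].
Definition dmul i q : P := 'X_(rshift n i) * q + q^`M(lshift n i).
Definition dmon m q : P := foldr (fun i => iter (m (rshift n i)) (dmul i)) q (enum 'I_n).
Definition wmul p q : P := \sum_(m <- msupp p) p@_m *: (xmon m * dmon m q).

Lemma dmulC i j q : dmul i (dmul j q) = dmul j (dmul i q).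
Proof.
rewrite /dmul !mderivD !mderivM !mderivX !mnmE !(eq_lrshift, eq_rlshift) /=.
rewrite !scale0r !mul0r !add0r (mderiv_comm (lshift n j)) !mulrDr !mulrA.
by rewrite ['X_(rshift n i) * _]mulrC -!addrA; congr (_ + _); rewrite !addrA [X in X + _]addrC.
Qed.

Lemma dmul_is_linear i : linear (dmul i).
Proof. by move=> c p q; rewrite /dmul linearP /= mulrDr -scalerAr scalerDr addrACA. Qed.

Lemma iter_linear k (f : P -> P) : linear f -> linear (iter k f).
Proof. by move=> lf; elim: k => // k IH c p q; rewrite !iterS IH lf. Qed.

Lemma dmon_is_linear m : linear (dmon m).
Proof.
rewrite /dmon; elim: (enum _) => //= i s IH c p q.
by rewrite IH (iter_linear _ (dmul_is_linear i)).
Qed.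

Lemma iter_dmulC k i l j q :
  iter k (dmul i) (iter l (dmul j) q) = iter l (dmul j) (iter k (dmul i) q).
Proof.
elim: k => //= k ->; elim: l => //= l IH; by rewrite dmulC IH.
Qed.

Lemma dmonS m i q : dmon (m + U_(rshift n i)) q = dmul i (dmon m q).
Proof.
rewrite /dmon.
have : i \in enum 'I_n by rewrite mem_enum.
have : uniq (enum 'I_n) by exact: enum_uniq.
elim: (enum _) => //= j s IH /andP[njs us]; rewrite inE mnmDE mnm1E eq_rshift.
have [->|nij] /= := eqVneq i j.
  move=> _; rewrite addn1 /=; congr (dmul _ (iter _ _ _)).
  elim: s njs {IH us} => //= k s IH; rewrite inE negb_or => /andP[njk /IH ->].
  by rewrite mnmDE mnm1E eq_rshift (negPf njk) addn0.
move=> ins; rewrite addn0 IH //.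
exact: (iter_dmulC _ _ 1).
Qed.

Lemma eq_dmon m1 m2 q :
  (forall i, m1 (rshift n i) = m2 (rshift n i)) -> dmon m1 q = dmon m2 q.
Proof. by move=> e; rewrite /dmon; elim: (enum _) => //= i s ->; rewrite e. Qed.

Lemma dmonSl m i q : dmon (m + U_(lshift n i)) q = dmon m q.
Proof. by apply: eq_dmon => j; rewrite mnmDE mnm1E eq_lrshift addn0. Qed.

Lemma xpart_l m i : xpart m (lshift n i) = m (lshift n i).
Proof. by rewrite mnmE (unsplitK (inl i)). Qed.

Lemma xpart_r m i : xpart m (rshift n i) = 0%N.
Proof. by rewrite mnmE (unsplitK (inr i)). Qed.

Lemma mnm_lr m1 m2 : (forall i, m1 (lshift n i) = m2 (lshift n i)) ->
  (forall i, m1 (rshift n i) = m2 (rshift n i)) -> m1 = m2.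
Proof. by move=> l r; apply/mnmP=> j; rewrite -(splitK j); case: fintype.split. Qed.

Lemma xmonSl m i : xmon (m + U_(lshift n i)) = 'X_(lshift n i) * xmon m.
Proof.
rewrite /xmon -mpolyXD; congr 'X_[_]; apply: mnm_lr => j.
  by rewrite mnmDE !xpart_l mnmDE addnC.
by rewrite mnmDE !xpart_r mnm1E eq_lrshift.
Qed.

Lemma xmonS m i : xmon (m + U_(rshift n i)) = xmon m.
Proof.
congr 'X_[_]; apply: mnm_lr => j; last by rewrite !xpart_r.
by rewrite !xpart_l mnmDE mnm1E eq_rlshift addn0.
Qed.

Lemma wmul_linl q : linear (wmul^~ q).
Proof. exact: (mlin_is_linear (fun m => xmon m * dmon m q)). Qed.

Lemma wmul_linr p : linear (wmul p).
Proof.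
move=> c q r; rewrite /wmul scaler_sumr -big_split /=; apply: eq_bigr => m _.
by rewrite dmon_is_linear mulrDr scalerDr -!scalerAr !scalerA mulrC.
Qed.

Lemma wmulXl m q : wmul 'X_[m] q = xmon m * dmon m q.
Proof. exact: (mlinX (fun m => xmon m * dmon m q)). Qed.

Lemma wmul_x i p q : wmul ('X_(lshift n i) * p) q = 'X_(lshift n i) * wmul p q.
Proof.
pose f p := wmul ('X_(lshift n i) * p) q.
pose h p := 'X_(lshift n i) * wmul p q.
suff : f =1 h by apply.
apply: mlin_ext => [c a b|c a b|m]; rewrite /f /h.
- by rewrite mulrDr -scalerAr wmul_linl.
- by rewrite wmul_linl mulrDr -scalerAr.
by rewrite -mpolyXD !wmulXl addmC xmonSl dmonSl mulrA.
Qed.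

Lemma mderiv_xmon m i :
  (xmon m)^`M(lshift n i) = (m (lshift n i))%:R *: xmon (m - U_(lshift n i)).
Proof.
rewrite mderivX xpart_l; congr (_ *: 'X_[_]); apply: mnm_lr => j.
  by rewrite mnmBE !xpart_l mnmBE.
by rewrite mnmBE !xpart_r sub0n.
Qed.

Lemma dmulX m i : dmul i 'X_[m] =
  (m (lshift n i))%:R *: 'X_[m - U_(lshift n i)] + 'X_[m + U_(rshift n i)].
Proof. by rewrite /dmul -mpolyXD mderivX addrC addmC. Qed.

Lemma wmul_d i p q : wmul (dmul i p) q = dmul i (wmul p q).
Proof.
pose f p := wmul (dmul i p) q.
pose h p := dmul i (wmul p q).
suff : f =1 h by apply.
apply: mlin_ext => [c a b|c a b|m]; rewrite /f /h.
- by rewrite dmul_is_linear wmul_linl.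
- by rewrite wmul_linl dmul_is_linear.
rewrite dmulX wmul_linl !wmulXl xmonS dmonS /dmul mderivM mderiv_xmon -scalerAl.
rewrite mulrDr [in RHS]addrCA mulrCA; congr (_ *: (_ * _) + _).
by apply: eq_dmon => j; rewrite mnmBE mnm1E eq_lrshift subn0.
Qed.

Lemma dmon_wmul m p q : wmul (dmon m p) q = dmon m (wmul p q).
Proof.
rewrite /dmon; elim: (enum _) => //= i s <-.
by elim: (m _) => //= k <-; rewrite wmul_d.
Qed.

Lemma xmonE m : xmon m = \prod_(i < n) 'X_(lshift n i) ^+ m (lshift n i).
Proof.
rewrite /xmon mpolyXE_id big_split_ord /= [X in _ * X]big1 ?mulr1.
  by apply: eq_bigr => i _; rewrite xpart_l.
by move=> i _; rewrite xpart_r expr0.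
Qed.

Lemma xmon_wmul m p q : wmul (xmon m * p) q = xmon m * wmul p q.
Proof.
rewrite xmonE; elim: (index_enum _) => [|i s IH]; first by rewrite !big_nil !mul1r.
rewrite !big_cons -!mulrA -IH.
by elim: (m _) => [|k IHk]; rewrite ?expr0 ?mul1r // !exprS -!mulrA wmul_x IHk.
Qed.

Lemma wmulA : associative wmul.
Proof.
move=> p q r; apply/esym.
pose f p := wmul (wmul p q) r; pose h p := wmul p (wmul q r).
suff : f =1 h by apply.
apply: mlin_ext => [c a b|c a b|m]; rewrite /f /h ?wmul_linl //.
by rewrite !wmulXl xmon_wmul dmon_wmul.
Qed.

Lemma wmul1 : left_id 1 wmul.
Proof.
move=> q; rewrite -mpolyX0 wmulXl.
have -> : xmon 0 = 1.
  by rewrite /xmon -mpolyX0; congr 'X_[_]; apply: mnm_lr => i; rewrite ?xpart_l ?xpart_r ?mnm0E.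
by rewrite mul1r /dmon; elim: (enum _) => //= i s ->; rewrite mnm0E.
Qed.

Lemma dmon1 m : dmon m 1 = \prod_(i < n) 'X_(rshift n i) ^+ m (rshift n i).
Proof.
rewrite /dmon -big_enum /=; elim: (enum _) => [|i s IH]; first by rewrite big_nil.
rewrite big_cons /= IH; set q := \prod_(_ <- s) _.
have dX j k r : r^`M(lshift n i) = 0 ->
    ('X_(rshift n j) ^+ k * r)^`M(lshift n i) = 0.
  move=> r0; elim: k => [|k IHk]; first by rewrite mul1r.
  by rewrite exprS -mulrA mderivM mderivX mnm1E eq_rlshift scale0r mul0r IHk mulr0 addr0.
have dq : q^`M(lshift n i) = 0.
  rewrite /q; elim: s {IH q} => [|j s IH]; last by rewrite big_cons dX.
  by rewrite big_nil -mpolyC1 mderivC.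
elim: (m _) => [|k IHk]; first by rewrite mul1r.
by rewrite iterS IHk /dmul dX // addr0 mulrA -exprS.
Qed.

Lemma wmulr1 : right_id 1 wmul.
Proof.
move=> p; pose f p := wmul p 1; suff : f =1 id by apply.
apply: mlin_ext => [c a b|c a b //|m]; rewrite /f ?wmul_linl // wmulXl.
by rewrite dmon1 xmonE [RHS]mpolyXE_id big_split_ord.
Qed.
End WeylProduct.

(* An element of the Weyl algebra is stored through its normally ordered
   expression: [symbol] has a variable for each x_i (index [lshift n i]) and for
   each d/dx_i (index [rshift n i]), and a monomial with exponent m stands for
   the product of the x's followed by the product of the derivations. *)
Record weyl (F : comNzRingType) (n : nat) := Weyl { symbol : {mpoly F[n + n]} }.

Section WeylRing.
Variables (F : comNzRingType) (n : nat).
Local Notation W := (weyl F n).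
Implicit Types P Q : W.

HB.instance Definition _ := [isNew for @symbol F n].
HB.instance Definition _ := [Choice of W by <:].

Definition weyl_zero : W := Weyl 0.
Definition weyl_opp P : W := Weyl (- symbol P).
Definition weyl_add P Q : W := Weyl (symbol P + symbol Q).
Definition weyl_one : W := Weyl 1.
Definition weyl_mul P Q : W := Weyl (wmul (symbol P) (symbol Q)).

Lemma weyl_addA : associative weyl_add.
Proof. by move=> P Q T; rewrite /weyl_add addrA. Qed.
Lemma weyl_addC : commutative weyl_add.
Proof. by move=> P Q; rewrite /weyl_add addrC. Qed.
Lemma weyl_add0 : left_id weyl_zero weyl_add.
Proof. by case=> p; rewrite /weyl_add add0r. Qed.
Lemma weyl_addN : left_inverse weyl_zero weyl_opp weyl_add.
Proof. by case=> p; rewrite /weyl_add addNr. Qed.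

HB.instance Definition _ :=
  GRing.isZmodule.Build W weyl_addA weyl_addC weyl_add0 weyl_addN.

Lemma weyl_mulA : associative weyl_mul.
Proof. by move=> P Q T; rewrite /weyl_mul wmulA. Qed.
Lemma weyl_mul1 : left_id weyl_one weyl_mul.
Proof. by case=> p; rewrite /weyl_mul wmul1. Qed.
Lemma weyl_mulr1 : right_id weyl_one weyl_mul.
Proof. by case=> p; rewrite /weyl_mul wmulr1. Qed.
Lemma weyl_mulDl : left_distributive weyl_mul weyl_add.
Proof.
move=> P Q T; congr Weyl.
by have := wmul_linl (symbol T) 1 (symbol P) (symbol Q); rewrite !scale1r.
Qed.
Lemma weyl_mulDr : right_distributive weyl_mul weyl_add.
Proof.
move=> P Q T; congr Weyl.
by have := wmul_linr (symbol P) 1 (symbol Q) (symbol T); rewrite !scale1r.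
Qed.
Lemma weyl_one_neq0 : weyl_one != 0.
Proof. by apply/eqP => /(congr1 (@symbol F n)) /eqP; rewrite oner_eq0. Qed.

HB.instance Definition _ := GRing.Zmodule_isNzRing.Build W
  weyl_mulA weyl_mul1 weyl_mulr1 weyl_mulDl weyl_mulDr weyl_one_neq0.

End WeylRing.

(* The series [f] is the formal sum of the f(s) x^s over all s in F^n. *)
Definition series (F : comNzRingType) n := 'cV[F]_n -> F^o.

Section Action.
Variables (F : comNzRingType) (n : nat).
Local Notation series := (series F n).
Implicit Types (f g : series) (s : 'cV[F]_n) (m : 'X_{1..n + n}) (i : 'I_n).

(* x^a d^b maps x^t to [prod_i t_i (t_i - 1) ... (t_i - b_i + 1)] x^(t - b + a),
   so the coefficient of x^s in the image of f comes from t = s - a + b. *)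
Definition shift_back m s : 'cV[F]_n :=
  \col_i (s i 0 - (m (lshift n i))%:R + (m (rshift n i))%:R).

Definition mact m f : series := fun s =>
  let t := shift_back m s in
  (\prod_(i < n) \prod_(k < m (rshift n i)) (t i 0 - k%:R)) * f t.

Definition act (P : weyl F n) f : series :=
  \sum_(m <- msupp (symbol P)) (symbol P)@_m *: mact m f.

Definition sx i f : series := fun s => f (s - delta_mx i 0).
Definition sd i f : series := fun s => (s i 0 + 1) * f (s + delta_mx i 0).

Local Notation actp p f := (act (Weyl p) f).

Lemma actp_linear f : linear (fun p => actp p f).
Proof. exact: (mlin_is_linear (fun m => mact m f)). Qed.

Lemma actpX m f : actp 'X_[m] f = mact m f.
Proof. exact: (mlinX (fun m => mact m f)). Qed.

Lemma mactD m : linear (mact m).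
Proof.
move=> c f g; apply/funext => s; rewrite /mact.
by rewrite !fctE /= /GRing.scale /= mulrDr mulrCA.
Qed.

Lemma act_is_linear P : linear (act P).
Proof.
move=> c f g; rewrite /act scaler_sumr -big_split /=; apply: eq_bigr => m _.
by rewrite mactD scalerDr !scalerA mulrC.
Qed.

Lemma sx_linear i : linear (sx i).
Proof. by []. Qed.

Lemma sd_linear i : linear (sd i).
Proof.
by move=> c f g; apply/funext => s; rewrite /sd !fctE /GRing.scale /= mulrDr mulrCA.
Qed.

Lemma mact_x i m f : mact (m + U_(lshift n i)) f = sx i (mact m f).
Proof.
have mU : (forall j, ((m + U_(lshift n i))%MM (lshift n j) = m (lshift n j) + (i == j))%N) *
  (forall j, ((m + U_(lshift n i))%MM (rshift n j) = m (rshift n j))%N).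
  by split=> j; rewrite mnmDE mnm1E ?eq_lshift // eq_lrshift addn0.
have e s : shift_back (m + U_(lshift n i)) s = shift_back m (s - delta_mx i 0).
  by apply/colP => j; rewrite !mxE !mU natrD eqxx andbT eq_sym; ring.
apply/funext => s; rewrite /sx /mact e; congr (_ * _).
by apply: eq_bigr => j _; rewrite mU.
Qed.

Lemma sd_mact i m f : sd i (mact m f) =
  (m (lshift n i))%:R *: mact (m - U_(lshift n i)) f + mact (m + U_(rshift n i)) f.
Proof.
have mU : (forall j, ((m + U_(rshift n i))%MM (rshift n j) = m (rshift n j) + (i == j))%N) *
  (forall j, ((m + U_(rshift n i))%MM (lshift n j) = m (lshift n j))%N).
  by split=> j; rewrite mnmDE mnm1E ?eq_rshift // eq_rlshift addn0.
have mB : (forall j, ((m - U_(lshift n i))%MM (lshift n j) = m (lshift n j) - (i == j))%N) *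
  (forall j, ((m - U_(lshift n i))%MM (rshift n j) = m (rshift n j))%N).
  by split=> j; rewrite mnmBE mnm1E ?eq_lshift // eq_lrshift subn0.
have eD s : shift_back (m + U_(rshift n i)) s = shift_back m (s + delta_mx i 0).
  by apply/colP => j; rewrite !mxE !mU natrD eqxx andbT eq_sym; ring.
apply/funext => s; rewrite /sd !fctE /GRing.scale /= {3}/mact eD.
set t := shift_back _ _.
have -> : \prod_(j < n) \prod_(k < (m + U_(rshift n i))%MM (rshift n j)) (t j 0 - k%:R)
  = (\prod_(j < n) \prod_(k < m (rshift n j)) (t j 0 - k%:R)) *
    (s i 0 + 1 - (m (lshift n i))%:R).
  rewrite (bigD1 i) //= [in RHS](bigD1 i) //= mU eqxx addn1 big_ord_recr /=.
  rewrite !mxE !eqxx /= -!mulrA; congr (_ * _); rewrite mulrC; congr (_ * _).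
    by apply: eq_bigr => j nij; rewrite mU eq_sym (negPf nij) addn0.
  by ring.
have -> : (m (lshift n i))%:R * mact (m - U_(lshift n i)) f s
  = (m (lshift n i))%:R * mact m f (s + delta_mx i 0).
  have [->|a0] := posnP (m (lshift n i)); first by rewrite !mul0r.
  congr (_ * _); rewrite /mact -/t.
  have -> : shift_back (m - U_(lshift n i)) s = t.
    apply/colP => j; rewrite !mxE !mB eqxx andbT (eq_sym j).
    have [<-|_] /= := eqVneq i j; last by rewrite subn0; ring.
    by rewrite natrB //; ring.
  by congr (_ * _); apply: eq_bigr => j _; rewrite mB.
by rewrite /mact -/t; ring.
Qed.

Lemma act_x i p f : actp ('X_(lshift n i) * p) f = sx i (actp p f).
Proof.
pose f1 p := actp ('X_(lshift n i) * p) f; pose f2 p := sx i (actp p f).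
suff : f1 =1 f2 by apply.
apply: mlin_ext => [c a b|c a b|m]; rewrite /f1 /f2.
- by rewrite mulrDr -scalerAr actp_linear.
- by rewrite actp_linear sx_linear.
by rewrite -mpolyXD addmC !actpX mact_x.
Qed.

Lemma act_d i p f : actp (dmul i p) f = sd i (actp p f).
Proof.
pose f1 p := actp (dmul i p) f; pose f2 p := sd i (actp p f).
suff : f1 =1 f2 by apply.
apply: mlin_ext => [c a b|c a b|m]; rewrite /f1 /f2.
- by rewrite dmul_is_linear actp_linear.
- by rewrite actp_linear sd_linear.
by rewrite dmulX actp_linear !actpX sd_mact.
Qed.

Lemma act1 f : act 1 f = f.
Proof.
rewrite -[1]/(Weyl 1) -mpolyX0 actpX; apply/funext => s; rewrite /mact.
rewrite big1 => [|i _]; last by rewrite mnm0E big_ord0.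
by rewrite mul1r; congr f; apply/colP => i; rewrite mxE !mnm0E subr0 addr0.
Qed.

Lemma actM (P Q : weyl F n) f : act (P * Q) f = act P (act Q f).
Proof.
case: P Q => [p] [q]; rewrite -[LHS]/(actp (wmul p q) f).
pose S p := actp (wmul p q) f = actp p (actp q f); suff : S p by [].
have Sx i r : S r -> S ('X_(lshift n i) * r) by rewrite /S wmul_x !act_x => ->.
have Sd i r : S r -> S (dmul i r) by rewrite /S wmul_d !act_d => ->.
have S1 : S 1 by rewrite /S wmul1 [RHS]act1.
pose f1 p := actp (wmul p q) f; pose f2 p := actp p (actp q f).
suff : f1 =1 f2 by apply.
apply: mlin_ext => [c a b|c a b|m]; rewrite /f1 /f2 ?wmul_linl ?actp_linear //.
rewrite -[_ = _]/(S _) -[X in S X]wmulr1 wmulXl xmonE.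
have : S (dmon m 1).
  by rewrite /dmon; elim: (enum _) => //= i s Ss; elim: (m _) => //= k; apply: Sd.
elim: (index_enum _) (dmon m 1) => [|i s IH] r Sr; first by rewrite big_nil mul1r.
rewrite big_cons -mulrA; elim: (m _) => [|k IHk]; first by rewrite mul1r; exact: IH.
by rewrite exprS -mulrA; exact: Sx.
Qed.
End Action.

Section LinearAlgebra.
Variables (F : pzRingType) (V : lmodType F).

Definition lin_span (S : set V) : set V :=
  [set f | exists k (c : 'I_k -> F) (b : 'I_k -> V),
     (forall i, S (b i)) /\ f = \sum_i c i *: b i].

Definition lin_indep (B : set V) : Prop :=
  forall k (c : 'I_k -> F) (b : 'I_k -> V), injective b ->
    (forall i, B (b i)) -> \sum_i c i *: b i = 0 -> forall i, c i = 0.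

Definition is_basis (B S : set V) : Prop := lin_indep B /\ lin_span B = S.

End LinearAlgebra.

(* The left ideal generated by [S]. *)
Definition ideal_gen (T : pzRingType) (S : set T) : set T :=
  [set p | exists k (c s : 'I_k -> T),
     (forall i, S (s i)) /\ p = \sum_i c i * s i].

Definition dotv (T : pzRingType) n (u v : 'cV[T]_n) : T := \sum_i u i 0 * v i 0.
Definition sumv (T : nmodType) n (u : 'cV[T]_n) : T := \sum_i u i 0.
Definition intv (T : pzRingType) n (u : 'cV[int]_n) : 'cV[T]_n := map_mx intr u.
Definition mnmv (T : pzRingType) n (u : 'X_{1..n}) : 'cV[T]_n := \col_i (u i)%:R.

Definition is_integer (T : pzRingType) (z : T) : Prop := exists k : int, z = k%:~R.

Section InitialIdeals.
Variables (R : realType) (n : nat).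
Local Notation C := R[i].

Definition init_form k (wt : 'X_{1..k} -> R) (p : {mpoly C[k]}) : {mpoly C[k]} :=
  \sum_(m <- msupp p | all (fun m' => wt m' <= wt m) (msupp p)) p@_m *: 'X_[m].

Definition init_ideal (w : 'cV[R]_n) (I : set {mpoly C[n]}) : set {mpoly C[n]} :=
  ideal_gen (init_form (fun m => dotv w (mnmv R m)) @` [set p | I p /\ p != 0]).

Definition weyl_weight (w : 'cV[R]_n) (m : 'X_{1..n + n}) : R :=
  \sum_i (- w i 0 * (m (lshift n i))%:R + w i 0 * (m (rshift n i))%:R).

Definition weyl_init_form (w : 'cV[R]_n) (P : weyl C n) : weyl C n :=
  Weyl (init_form (weyl_weight w) (symbol P)).

Definition weyl_init_ideal (w : 'cV[R]_n) (J : set (weyl C n)) : set (weyl C n) :=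
  ideal_gen (weyl_init_form w @` [set P | J P /\ P != 0]).

End InitialIdeals.

Section StandardPairs.
Variables (R : realType) (n : nat).
Local Notation C := R[i].
Implicit Types (X Y Z : set 'cV[C]_n).

Definition zariski_closure X : set 'cV[C]_n :=
  [set z | forall p : {mpoly C[n]},
     (forall x, X x -> p.@[fun i => x i 0] = 0) -> p.@[fun i => z i 0] = 0].

Definition zariski_closed X : Prop := zariski_closure X = X.

Definition zariski_irreducible X : Prop :=
  X !=set0 /\ forall Y Z, zariski_closed Y -> zariski_closed Z ->
    X `<=` Y `|` Z -> X `<=` Y \/ X `<=` Z.

Definition irreducible_component Z X : Prop :=
  [/\ Z `<=` X, zariski_irreducible Z &
      forall Y, zariski_irreducible Y -> Y `<=` X -> Z `<=` Y -> Y = Z].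

Definition alpha_plus (alpha : 'X_{1..n}) (sigma : {set 'I_n}) : set 'cV[C]_n :=
  [set z | forall i, i \notin sigma -> z i 0 = (alpha i)%:R].

Definition standard_pair (I : set {mpoly C[n]}) (alpha : 'X_{1..n})
    (sigma : {set 'I_n}) : Prop :=
  irreducible_component (alpha_plus alpha sigma)
    (zariski_closure [set mnmv C u | u in [set u | ~ I 'X_[u]]]) /\
  forall b : 'X_{1..n}, alpha_plus alpha sigma (mnmv C b) -> forall i, (alpha i <= b i)%N.

End StandardPairs.

Section Hypergeometric.
Variables (R : realType) (d n : nat) (A : 'M[int]_(d, n)).
Local Notation C := R[i].
Implicit Types (w : 'cV[R]_n) (beta : 'cV[C]_d) (f : series C n) (v : 'cV[C]_n).

Definition columns_generate : Prop :=
  forall z : 'cV[int]_d, exists u : 'cV[int]_n, A *m u = z.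

Definition ones_in_row_span : Prop :=
  exists c : 'rV[rat]_d, c *m map_mx intr A = const_mx 1.

(* C[d_1, ..., d_n] is [{mpoly C[n]}]. *)
Definition toric_ideal : set {mpoly C[n]} :=
  ideal_gen [set p | exists u v : 'X_{1..n},
    A *m mnmv int u = A *m mnmv int v /\ p = 'X_[u] - 'X_[v]].

Definition weyl_of_dpoly (p : {mpoly C[n]}) : weyl C n :=
  Weyl (mmap (@mpolyC (n + n) C) (fun i => 'X_(rshift n i)) p).

Definition euler beta (i : 'I_d) : weyl C n :=
  Weyl (\sum_j (A i j)%:~R *: ('X_(lshift n j) * 'X_(rshift n j)) - (beta i 0)%:MP).

(* D.K + <E - beta> *)
Definition with_euler beta (K : set {mpoly C[n]}) : set (weyl C n) :=
  ideal_gen (weyl_of_dpoly @` K `|` range (euler beta)).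

Definition hypergeometric beta : set (weyl C n) := with_euler beta toric_ideal.

Definition solution (J : set (weyl C n)) f : Prop := forall P, J P -> act P f = 0.

(* The rows of M are the inner normals of the facets; for a nonempty X the
   closure of X is cut out by the weak inequalities. *)
Definition strongly_convex_open_rational_cone (X : set 'cV[R]_n) : Prop :=
  exists k (M : 'M[int]_(k, n)),
    X = [set w | forall i, 0 < (map_mx intr M *m w) i 0] /\
    forall u : 'cV[R]_n, (forall i, 0 <= (map_mx intr M *m u) i 0) ->
      (forall i, 0 <= (map_mx intr M *m - u) i 0) -> u = 0.

Definition weight_cone beta w (X : set 'cV[R]_n) : Prop :=
  [/\ strongly_convex_open_rational_cone X, X w,
      ones_in_row_span \/ X `<=` [set w' | forall i, 0 < w' i 0],
      forall w', X w' -> init_ideal w toric_ideal = init_ideal w' toric_ideal &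
      forall w', X w' -> weyl_init_ideal w (hypergeometric beta)
                       = weyl_init_ideal w' (hypergeometric beta)].

Definition weight_vector beta w : Prop := exists X, weight_cone beta w X.

Definition dual_cone (X : set 'cV[R]_n) : set 'cV[R]_n :=
  [set u | forall w', X w' -> 0 <= dotv u w'].

Definition logfree_solution beta w v f : Prop :=
  solution (hypergeometric beta) f /\
  exists X (U : set 'cV[int]_n),
    [/\ weight_cone beta w X,
        U `<=` [set u | dual_cone X (intv R u) /\ A *m u = 0] &
        forall s, f s != 0 -> exists u, U u /\ s = v + intv C u].

(* For constant coefficients the bound on the degrees of the p_u is vacuous. *)
Definition logfree_basic_nilsson beta w v f : Prop :=
  logfree_solution beta w v f /\ f v != 0.

Definition logfree_space beta w : set (series C n) :=
  lin_span [set f | exists v, logfree_solution beta w v f].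

Definition monomial_series v : series C n := fun s => (s == v)%:R.

Definition fake_exponent beta w v : Prop :=
  solution (with_euler beta (init_ideal w toric_ideal)) (monomial_series v).

Definition corresponds beta v (alpha : 'X_{1..n}) (sigma : {set 'I_n}) : Prop :=
  map_mx intr A *m v = beta /\ alpha_plus alpha sigma v.

Definition homogenizing_value beta w (beta0 : C) : Prop :=
  ~ is_integer beta0 /\
  forall v, fake_exponent beta w v -> ~ is_integer (beta0 - sumv v).

Definition rho_mx : 'M[int]_(1 + d, 1 + n) :=
  block_mx 1%:M (const_mx 1) 0 A.

End Hypergeometric.

Definition cons_col (T : pzSemiRingType) n (v0 : T) (v : 'cV[T]_n) : 'cV[T]_(1 + n) :=
  col_mx v0%:M v.

(* d^k x^s = dpow_coef s k * x^(s - k); k may be negative when s is not an integer. *)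
Definition dpow_coef (F : fieldType) (s : F) (k : int) : F :=
  match k with
  | Posz m => \prod_(j < m) (s - j%:R)
  | Negz m => (\prod_(j < m.+1) (s + j.+1%:R))^-1
  end.

(* g is the homogenization of f, a series with exponents in v + Z^n. *)
Definition homogenization (F : fieldType) n (beta0 : F) (v : 'cV[F]_n)
    (f : series F n) (g : series F (1 + n)) : Prop :=
  let e (u : 'cV[int]_n) :=
    cons_col (beta0 - sumv v - (sumv u)%:~R) (v + intv F u) in
  (forall u, g (e u) = dpow_coef (beta0 - sumv v) (sumv u) * f (v + intv F u)) /\
  (forall t, g t != 0 -> exists u, t = e u).

(* Main.v *)
(* Let s_0 = beta_0 - |v|, which is not an integer. Applying a product of K
   derivations to rho(phi) multiplies the coefficients of the corresponding
   derivative of phi by nonzero constants that depend only on K and the exponent,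
   and the two monomials of a binomial in I_rho(A) have the same degree; hence
   rho(phi) solves the homogenized system exactly when phi solves H_A(beta).

   The starting exponent of a series solution is killed by the initial ideal, so it
   lies on some standard pair; since its x_0-coordinate s_0 is not an integer, this
   pair passes through zero. Conversely, if (v_0, v) lies on a pair through zero,
   the x_0-coordinate is free along the pair, so homogenizing elements of I_A shows
   that v is a fake exponent of H_A(beta). Thus v_0 = beta_0 - |v| is not an integer
   and the solution can be dehomogenized.

   Elements of the basis with the same exponents modulo Z^n may start at different
   points; changing the base point only rescales a homogenization by a constant,
   so the spans agree. *)
Require Import Defs.
From HB Require Import structures.
From mathcomp Require Import all_boot all_order all_algebra.
From mathcomp Require Import boolp classical_sets functions reals.
From mathcomp.real_closed Require Import complex.
From mathcomp.multinomials Require Import mpoly.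
From mathcomp Require Import ring zify.
Set Implicit Arguments.
Unset Strict Implicit.
Unset Printing Implicit Defensive.
Import Order.TTheory GRing.Theory Num.Theory.
Local Open Scope classical_set_scope.
Local Open Scope ring_scope.

(** * Falling factorials and hypergeometric solutions *)

Section FallingFactorial.
Variable n : nat.
Implicit Types m a b u : 'X_{1..n}.

Lemma mnmvD (T : pzRingType) a b : mnmv T (a + b) = mnmv T a + mnmv T b.
Proof. by apply/colP => i; rewrite !mxE mnmDE natrD. Qed.

(** The scalar in d^m x^s = ff s m x^(s - m): a product of falling factorials. *)
Definition ff (F : comNzRingType) (s : 'cV[F]_n) m : F :=
  \prod_(i < n) \prod_(k < m i) (s i 0 - k%:R).

Lemma ffD (F : comNzRingType) (s : 'cV[F]_n) a b :
  ff s (a + b) = ff s b * ff (s - mnmv F b) a.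
Proof.
rewrite /ff -big_split /=; apply: eq_bigr => i _.
rewrite mnmDE addnC big_split_ord /=; congr (_ * _).
by apply: eq_bigr => k _; rewrite !mxE natrD opprD addrA.
Qed.

Lemma ff_eq0 (F : numFieldType) (s : 'cV[F]_n) m :
  ff s m = 0 -> exists i k, (k < m i)%N /\ s i 0 = k%:R.
Proof.
move/eqP; rewrite prodf_seq_eq0 => /hasP[i _] /=.
rewrite prodf_seq_eq0 => /hasP[k _] /=; rewrite subr_eq0 => /eqP e.
by exists i, k; split.
Qed.

Lemma ff0_lt (F : comNzRingType) (s : 'cV[F]_n) m i k :
  (k < m i)%N -> s i 0 = k%:R -> ff s m = 0.
Proof.
move=> lt e; rewrite /ff (bigD1 i) //= (bigD1 (Ordinal lt)) //=.
by rewrite e subrr !mul0r.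
Qed.

Lemma ff_mnmv (F : numFieldType) u m : ff (mnmv F u) m != 0 -> (m <= u)%MM.
Proof.
move=> h; apply/mnm_lepP => i; rewrite leqNgt; apply: contra h => lt.
by rewrite (ff0_lt lt) // mxE.
Qed.

(** The action of d^m on a series; the term x^s of the result comes from x^(s + m). *)
Definition dop (F : comNzRingType) m (f : series F n) : series F n := fun s =>
  ff (s + mnmv F m) m * f (s + mnmv F m).

End FallingFactorial.

Section HypergeometricAction.
Variables (F : comNzRingType) (n : nat).
Implicit Types (m a b u : 'X_{1..n}) (f : series F n) (P Q : weyl F n).

Lemma weyl_mono_d m :
  mmap1 (fun i => 'X_(rshift n i) : {mpoly F[n + n]}) m =
  'X_[[multinom (match fintype.split j with inl _ => 0%N | inr k => m k end) | j < n + n]].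
Proof.
rewrite /mmap1 [RHS]mpolyXE_id big_split_ord /= [X in X * _]big1 ?mul1r; last first.
  by move=> i _; rewrite mnmE (unsplitK (inl i)).
by apply: eq_bigr => i _; rewrite mnmE (unsplitK (inr i)).
Qed.

Lemma act_d_mono m f : mact
  [multinom (match fintype.split j with inl _ => 0%N | inr k => m k end) | j < n + n] f
  = dop m f.
Proof.
apply/funext => s; rewrite /mact /dop /ff.
have -> : shift_back
  [multinom (match fintype.split j with inl _ => 0%N | inr k => m k end) | j < n + n] s
  = s + mnmv F m.
  by apply/colP => i; rewrite !mxE !mnmE (unsplitK (inl i)) (unsplitK (inr i)) subr0.
congr (_ * _); apply: eq_bigr => i _.
by rewrite mnmE (unsplitK (inr i)).
Qed.

Lemma actDl P Q f : act (P + Q) f = act P f + act Q f.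
Proof.
case: P Q => [p] [q]; have := actp_linear f 1 p q.
by rewrite !scale1r.
Qed.

Lemma act0l f : act 0 f = 0.
Proof. by rewrite /act msupp0 big_nil. Qed.

Lemma act0r P : act P 0 = 0.
Proof. by have := act_is_linear P (-1) 0 0; rewrite scaler0 add0r scaleN1r addNr. Qed.

Lemma mmap_sum_d (p : {mpoly F[n]}) :
  mmap (@mpolyC (n + n) F) (fun i => 'X_(rshift n i)) p =
  \sum_(m <- msupp p) p@_m *: mmap1 (fun i => 'X_(rshift n i)) m.
Proof. by rewrite /mmap; apply: eq_bigr => m _; rewrite mul_mpolyC. Qed.

Lemma actp_sum (T : Type) (r : seq T) (g : T -> {mpoly F[n + n]}) (c : T -> F) f :
  act (Weyl (\sum_(i <- r) c i *: g i)) f = \sum_(i <- r) c i *: act (Weyl (g i)) f.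
Proof.
elim: r => [|i r IH]; first by rewrite !big_nil -[RHS](act0l f).
by rewrite !big_cons actp_linear IH.
Qed.

End HypergeometricAction.

Lemma act_dpoly (R : realType) n (p : {mpoly R[i][n]}) (f : series R[i] n) :
  act (weyl_of_dpoly p) f = \sum_(m <- msupp p) p@_m *: dop m f.
Proof.
rewrite /weyl_of_dpoly mmap_sum_d actp_sum; apply: eq_bigr => m _; congr (_ *: _).
by rewrite weyl_mono_d actpX act_d_mono.
Qed.

Lemma act_dpolyB (R : realType) n (a b : 'X_{1..n}) (f : series R[i] n) :
  act (weyl_of_dpoly ('X_[a] - 'X_[b])) f = dop a f - dop b f.
Proof.
have -> : weyl_of_dpoly ('X_[a] - 'X_[b] : {mpoly R[i][n]}) =
   Weyl (\sum_(x <- [:: (1, a); (-1, b)]) x.1 *: mmap1 (fun i => 'X_(rshift n i)) x.2).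
  rewrite /weyl_of_dpoly !big_cons big_nil /= addr0 scale1r scaleN1r.
  by rewrite mmapB !mmapX.
rewrite actp_sum !big_cons big_nil /= addr0 scale1r scaleN1r.
by rewrite !weyl_mono_d !actpX !act_d_mono.
Qed.

Lemma act_euler (R : realType) d n (A : 'M[int]_(d, n)) (beta : 'cV[R[i]]_d) i
    (f : series R[i] n) s :
  act (euler A beta i) f s = ((map_mx intr A *m s) i 0 - beta i 0) * f s.
Proof.
have -> : euler A beta i = Weyl (\sum_j (A i j)%:~R *:
    ('X_(lshift n j) * 'X_(rshift n j))) + Weyl (\sum_(x <- [:: tt]) (- beta i 0) *: 1).
  by rewrite big_seq1 scaleNr /euler -mul_mpolyC mulr1.
rewrite actDl !actp_sum big_seq1 -[Weyl 1]/(1 : weyl _ _) act1 mulrBl.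
rewrite !fctE /GRing.scale /= mulNr; congr (_ - _).
rewrite mxE mulr_suml fct_sumE; apply: eq_bigr => j _.
rewrite mxE -mulrA; congr (_ * _).
have -> : 'X_(rshift n j) = dmul j 1 :> {mpoly R[i][n + n]}.
  by rewrite /dmul mulr1 -mpolyC1 mderivC addr0.
rewrite act_x /sx act_d -[Weyl 1]/(1 : weyl _ _) act1 /sd.
by rewrite subrK !mxE !eqxx subrK.
Qed.

Section LinearFunction.
Variables (F : pzRingType) (U V : lmodType F) (f : U -> V).
Hypothesis lf : linear f.

Lemma linear_fun0 : f 0 = 0.
Proof. by have := lf (-1) 0 0; rewrite scaler0 add0r scaleN1r addNr. Qed.

Lemma linear_funD x y : f (x + y) = f x + f y.
Proof. by have := lf 1 x y; rewrite !scale1r. Qed.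

Lemma linear_funZ c x : f (c *: x) = c *: f x.
Proof. by have := lf c x 0; rewrite linear_fun0 !addr0. Qed.

End LinearFunction.

Section IdealGen.
Variables (T : pzRingType) (S : set T).

Lemma ideal_gen_sub x : S x -> ideal_gen S x.
Proof.
move=> Sx; exists 1%N, (fun=> 1), (fun=> x); split=> //.
by rewrite big_ord1 mul1r.
Qed.

Lemma ideal_gen_ind (P : T -> Prop) : P 0 -> (forall x y, P x -> P y -> P (x + y)) ->
  (forall c s, S s -> P (c * s)) -> forall x, ideal_gen S x -> P x.
Proof.
move=> P0 PD PM x [k [c [s [Ss ->]]]].
by elim/big_ind: _ => // i _; apply: PM.
Qed.

Lemma ideal_gen0 : ideal_gen S 0.
Proof.
exists 0%N, (fun=> 0), (fun=> 0); split; first by case.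
by rewrite big_ord0.
Qed.

Lemma ideal_genD x y : ideal_gen S x -> ideal_gen S y -> ideal_gen S (x + y).
Proof.
move=> [k [c [s [Ss ->]]]] [l [c' [s' [Ss' ->]]]].
pose g T' (f : 'I_k -> T') (f' : 'I_l -> T') (i : 'I_(k + l)) :=
  match fintype.split i with inl j => f j | inr j => f' j end.
exists (k + l)%N, (g _ c c'), (g _ s s'); split=> [i|].
  by rewrite /g; case: fintype.split.
rewrite big_split_ord /=; congr (_ + _); apply: eq_bigr => i _; rewrite /g.
  by rewrite (unsplitK (inl i)).
by rewrite (unsplitK (inr i)).
Qed.

Lemma ideal_genM c x : ideal_gen S x -> ideal_gen S (c * x).
Proof.
move=> [k [c' [s [Ss ->]]]]; exists k, (fun i => c * c' i), s; split=> //.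
by rewrite mulr_sumr; apply: eq_bigr => i _; rewrite mulrA.
Qed.

End IdealGen.

(** * Toric ideals and the equations of a hypergeometric system *)

Section ToricIdeal.
Variables (R : realType) (d n : nat) (A : 'M[int]_(d, n)).
Local Notation C := R[i].
Implicit Types (a b : 'X_{1..n}) (p q : {mpoly C[n]}).

(** A monomial times a binomial whose exponents have equal images under A is again such a binomial,
    so these binomials span the ideal linearly and scalar multiples suffice. *)
Lemma toric_ideal_ind (P : {mpoly C[n]} -> Prop) :
  P 0 -> (forall p q, P p -> P q -> P (p + q)) ->
  (forall c a b, A *m mnmv int a = A *m mnmv int b -> P (c *: ('X_[a] - 'X_[b]))) ->
  forall p, toric_ideal A p -> P p.
Proof.
move=> P0 PD PB; apply: ideal_gen_ind => // c _ [a [b [eab ->]]].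
rewrite (mpolyE c) mulr_suml; elim/big_ind: _ => // m _.
rewrite -scalerAl mulrBr -!mpolyXD; apply: PB.
by rewrite !mnmvD !mulmxDr eab.
Qed.

Lemma toric_idealZ c p : toric_ideal A p -> toric_ideal A (c *: p).
Proof. by move=> Ip; rewrite -mul_mpolyC; apply: ideal_genM. Qed.

Lemma toric_idealB a b : A *m mnmv int a = A *m mnmv int b ->
  toric_ideal A ('X_[a] - 'X_[b] : {mpoly C[n]}).
Proof. by move=> e; apply: ideal_gen_sub; exists a, b. Qed.

End ToricIdeal.

Section Solutions.
Variables (R : realType) (d n : nat) (A : 'M[int]_(d, n)).
Local Notation C := R[i].
Implicit Types (a b : 'X_{1..n}) (p q : {mpoly C[n]}) (f : series C n).

Lemma act_dpoly_linear f : linear (fun p => act (weyl_of_dpoly p) f).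
Proof.
move=> c p q; rewrite /weyl_of_dpoly mmapD mmapZ mul_mpolyC.
exact: actp_linear.
Qed.

Lemma act_dpoly_eq0 f p : toric_ideal A p ->
  (forall a b, A *m mnmv int a = A *m mnmv int b -> dop a f = dop b f) ->
  act (weyl_of_dpoly p) f = 0.
Proof.
move=> Ip tor; have lin := act_dpoly_linear f.
pose g p := act (weyl_of_dpoly p) f.
apply: (@toric_ideal_ind R d n A (fun p => g p = 0)) Ip => [|{}p q hp hq|c a b eab].
- exact: (linear_fun0 lin).
- have -> : g (p + q) = g p + g q := linear_funD lin p q.
  by rewrite hp hq addr0.
- have -> : g (c *: ('X_[a] - 'X_[b])) = c *: g ('X_[a] - 'X_[b]) := linear_funZ lin c _.
  by rewrite /g act_dpolyB (tor a b eab) subrr scaler0.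
Qed.

Lemma solution_ideal_gen (S : set (weyl C n)) f :
  (forall P, S P -> act P f = 0) -> solution (ideal_gen S) f.
Proof.
move=> h P; elim/ideal_gen_ind: P / => [|P Q hP hQ|c s Ss]; first exact: act0l.
- by rewrite actDl hP hQ addr0.
- by rewrite actM h // act0r.
Qed.

(** It suffices to test generators. The Euler operators are diagonal on monomials, so they only
    confine the support; each binomial equates two derivatives. *)
Lemma solution_hypergeometric (beta : 'cV[C]_d) f :
  solution (hypergeometric A beta) f <->
  (forall s, f s != 0 -> map_mx intr A *m s = beta) /\
  (forall a b, A *m mnmv int a = A *m mnmv int b -> dop a f = dop b f).
Proof.
split=> [sol|[eul tor]].
  split=> [s fs|a b eab].
    apply/colP => i.
    have /(congr1 (fun g : series C n => g s)) : act (euler A beta i) f = 0.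
      by apply: sol; apply: ideal_gen_sub; right; exists i.
    rewrite act_euler => /eqP; rewrite mulf_eq0 (negPf fs) orbF subr_eq0.
    by move/eqP.
  apply/eqP; rewrite -subr_eq0 -act_dpolyB; apply/eqP; apply: sol.
  apply: ideal_gen_sub; left; exists ('X_[a] - 'X_[b]) => //.
  exact: toric_idealB.
apply: solution_ideal_gen => P [[p Ip <-]|[i _ <-]].
  exact: act_dpoly_eq0.
apply/funext => s; rewrite act_euler.
have [->|fs] := eqVneq (f s) 0; first by rewrite mulr0.
by rewrite eul // subrr mul0r.
Qed.

End Solutions.

(** * Coefficients of positive and negative powers of d_0 *)

Section DpowCoef.
Variable F : numFieldType.
Implicit Types (s : F) (k l : int).

Lemma is_integer_int k : is_integer (k%:~R : F).
Proof. by exists k. Qed.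

Lemma is_integerD (x y : F) : is_integer x -> is_integer y -> is_integer (x + y).
Proof. by move=> [k ->] [l ->]; exists (k + l); rewrite intrD. Qed.

Lemma nonint_sub s k : ~ is_integer s -> ~ is_integer (s - k%:~R).
Proof.
by move=> ns /is_integerD /(_ (is_integer_int k)); rewrite subrK.
Qed.

Lemma nonint_neq0 s : ~ is_integer s -> s != 0.
Proof. by move=> ns; apply/eqP => s0; apply: ns; rewrite s0; exists 0. Qed.

(** One recursion covers both branches of [dpow_coef]: for negative k the factor s - k cancels
    against the inverted product, being nonzero because s is not an integer. *)
Lemma dpow_coefS s k : ~ is_integer s ->
  dpow_coef s (k + 1) = dpow_coef s k * (s - k%:~R).
Proof.
move=> ns; case: k => [m|[|m]].
- by rewrite -[Posz m + 1]/(Posz (m + 1)%N) addn1 /= big_ord_recr.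
- rewrite /= big_ord0 big_ord1 opprK mulVf //.
  by have := nonint_neq0 (nonint_sub (k := -1) ns); rewrite opprK.
- rewrite (_ : Negz m.+1 + 1 = Negz m); last by lia.
  rewrite /= [in RHS]big_ord_recr /= invfM -mulrA NegzE mulrNz opprK mulVf ?mulr1 //.
  have := nonint_neq0 (nonint_sub (k := - (m.+2%:Z)) ns).
  by rewrite mulrNz opprK.
Qed.

Lemma dpow_coefDn s k (m : nat) : ~ is_integer s ->
  dpow_coef s (k + m) = dpow_coef s k * \prod_(j < m) (s - k%:~R - j%:R).
Proof.
move=> ns; elim: m => [|m IH]; first by rewrite big_ord0 mulr1 addr0.
rewrite -addn1 PoszD addrA dpow_coefS // IH addn1 big_ord_recr /= -mulrA.
by rewrite intrD opprD addrA.
Qed.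

Lemma dpow_coef_neq0 s k : ~ is_integer s -> dpow_coef s k != 0.
Proof.
move=> ns; case: k => m /=; rewrite ?invr_eq0.
  by apply/prodf_neq0 => i _; have := nonint_neq0 (nonint_sub (k := Posz i) ns).
apply/prodf_neq0 => i _.
by have := nonint_neq0 (nonint_sub (k := - (i.+1%:Z)) ns); rewrite mulrNz opprK.
Qed.

Lemma dpow_coef0 s : dpow_coef s 0 = 1.
Proof. by rewrite /= big_ord0. Qed.

(** For negative l, climbing from k + l to k and from l to 0 (the latter starting at s - k) produces
    the same product; the second climb shows that it is inverse to the coefficient of l. *)
Lemma dpow_coefD s k l : ~ is_integer s ->
  dpow_coef s (k + l) = dpow_coef s k * dpow_coef (s - k%:~R) l.
Proof.
move=> ns; have nsk := nonint_sub (k := k) ns.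
case: l => m; first by rewrite dpow_coefDn.
have := dpow_coefDn (k + Negz m) m.+1 ns.
have := dpow_coefDn (Negz m) m.+1 nsk.
rewrite (_ : Negz m + m.+1 = 0); last by lia.
rewrite (_ : k + Negz m + m.+1 = k); last by lia.
rewrite dpow_coef0 intrD opprD addrA => h ->.
by rewrite -mulrA [X in _ * X]mulrC -h mulr1.
Qed.

End DpowCoef.

(** * Homogenization of series *)

Section ConsCol.
Variable n : nat.

Definition mcons k (a : 'X_{1..n}) : 'X_{1..1 + n} :=
  [multinom (match fintype.split i with inl _ => k | inr j => a j end) | i < 1 + n].

Definition mtail (a : 'X_{1..1 + n}) : 'X_{1..n} := [multinom a (rshift 1 i) | i < n].

Lemma mcons_l k a i : mcons k a (lshift n i) = k.
Proof. by rewrite mnmE (unsplitK (inl i)). Qed.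

Lemma mcons_r k a i : mcons k a (rshift 1 i) = a i.
Proof. by rewrite mnmE (unsplitK (inr i)). Qed.

Lemma mconsK (a : 'X_{1..1 + n}) : mcons (a (lshift n ord0)) (mtail a) = a.
Proof.
apply/mnmP => i; rewrite -(splitK i); case: (fintype.split i) => j.
  by rewrite mcons_l (ord1 j).
by rewrite mcons_r mnmE.
Qed.

Lemma mcons_inj k l a b : mcons k a = mcons l b -> k = l /\ a = b.
Proof.
move=> e; split; first by rewrite -(mcons_l k a ord0) e mcons_l.
by apply/mnmP => i; rewrite -(mcons_r k a) e mcons_r.
Qed.

Section Ring.
Variable T : pzRingType.
Implicit Types (x y : T) (a b : 'cV[T]_n).

Lemma cons_col_l x a i : cons_col x a (lshift n i) 0 = x.
Proof. by rewrite col_mxEu mxE (ord1 i). Qed.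

Lemma cons_col_r x a i : cons_col x a (rshift 1 i) 0 = a i 0.
Proof. by rewrite col_mxEd. Qed.

Lemma cons_colP (s : 'cV[T]_(1 + n)) x a : s (lshift n ord0) 0 = x ->
  (forall i, s (rshift 1 i) 0 = a i 0) -> s = cons_col x a.
Proof.
move=> sx sa; apply/colP => i; rewrite -(splitK i); case: (fintype.split i) => j.
  by rewrite /= cons_col_l (ord1 j).
by rewrite /= cons_col_r sa.
Qed.

Lemma cons_colD x y a b : cons_col x a + cons_col y b = cons_col (x + y) (a + b).
Proof.
apply: cons_colP => [|i]; first by rewrite mxE !cons_col_l.
by rewrite mxE !cons_col_r mxE.
Qed.

Lemma cons_col_inj x y a b : cons_col x a = cons_col y b -> x = y /\ a = b.
Proof.
move=> e; split; first by rewrite -(cons_col_l x a ord0) e cons_col_l.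
by apply/colP => i; rewrite -(cons_col_r x a) e cons_col_r.
Qed.

Lemma mnmv_mcons k (m : 'X_{1..n}) : mnmv T (mcons k m) = cons_col k%:R (mnmv T m).
Proof.
apply: cons_colP => [|i]; first by rewrite mxE mcons_l.
by rewrite !mxE mcons_r.
Qed.

Lemma sumvD a b : sumv (a + b) = sumv a + sumv b.
Proof. by rewrite /sumv -big_split; apply: eq_bigr => i _; rewrite mxE. Qed.

Lemma sumvN a : sumv (- a) = - sumv a.
Proof. by rewrite /sumv -sumrN; apply: eq_bigr => i _; rewrite mxE. Qed.

Lemma sumv_mnmv (m : 'X_{1..n}) : sumv (mnmv T m) = (mdeg m)%:R :> T.
Proof. by rewrite mdegE natr_sum; apply: eq_bigr => i _; rewrite mxE. Qed.

Lemma sumv_intv (u : 'cV[int]_n) : sumv (intv T u) = (sumv u)%:~R.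
Proof. by rewrite /sumv rmorph_sum /=; apply: eq_bigr => i _; rewrite mxE. Qed.

End Ring.

Lemma intv0 (T : pzRingType) m : intv T (0 : 'cV[int]_m) = 0.
Proof. exact: map_mx0. Qed.

Lemma intvD (T : pzRingType) m (a b : 'cV[int]_m) : intv T (a + b) = intv T a + intv T b.
Proof. exact: map_mxD. Qed.

Lemma intvN (T : pzRingType) m (a : 'cV[int]_m) : intv T (- a) = - intv T a.
Proof. exact: map_mxN. Qed.

Lemma intv_mnmv (T : pzRingType) m (a : 'X_{1..m}) : intv T (mnmv int a) = mnmv T a.
Proof. by apply/colP => i; rewrite !mxE natz. Qed.

Lemma intv_inj (F : numFieldType) m : injective (@intv F m).
Proof.
move=> a b /colP e; apply/colP => i; have := e i; rewrite !mxE.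
by move/intr_inj.
Qed.

Lemma intv_cons (T : pzRingType) x (a : 'cV[int]_n) :
  intv T (cons_col x a) = cons_col x%:~R (intv T a).
Proof.
apply: cons_colP => [|i]; first by rewrite mxE cons_col_l.
by rewrite mxE cons_col_r mxE.
Qed.

Lemma ff_cons (F : comNzRingType) x (s : 'cV[F]_n) k a :
  ff (cons_col x s) (mcons k a) = \prod_(j < k) (x - j%:R) * ff s a.
Proof.
rewrite /ff big_split_ord big_ord1 /=; congr (_ * _).
  by rewrite cons_col_l mcons_l.
by apply: eq_bigr => i _; rewrite cons_col_r mcons_r.
Qed.

Lemma rho_mulE (T : pzRingType) d (A : 'M[int]_(d, n)) x (a : 'cV[T]_n) :
  map_mx intr (rho_mx A) *m cons_col x a = cons_col (x + sumv a) (map_mx intr A *m a).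
Proof.
rewrite map_block_mx mul_block_col map_mx0 mul0mx add0r /cons_col; congr col_mx.
apply/matrixP => i j; rewrite !mxE (ord1 i) (ord1 j) !big_ord1 !mxE !eqxx !mulr1n mul1r.
by congr (_ + _); apply: eq_bigr => k _; rewrite !mxE mul1r.
Qed.

Lemma rho_mulZE d (A : 'M[int]_(d, n)) x (a : 'cV[int]_n) :
  rho_mx A *m cons_col x a = cons_col (x + sumv a) (A *m a).
Proof.
have e k l (M : 'M[int]_(k, l)) : map_mx intr M = M.
  by apply/matrixP => i j; rewrite mxE intz.
by rewrite -[rho_mx A]e rho_mulE e.
Qed.

End ConsCol.

Section HomogenizedSolutions.
Variables (R : realType) (d n : nat) (A : 'M[int]_(d, n)).
Local Notation C := R[i].
Variables (beta : 'cV[C]_d) (beta0 : C) (v : 'cV[C]_n).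
Variables (f : series C n) (g : series C (1 + n)).
Local Notation s0 := (beta0 - sumv v).
Hypothesis s0_nint : ~ is_integer s0.
Hypothesis f_supp : forall s, f s != 0 -> exists u, s = v + intv C u.
Hypothesis hom : homogenization beta0 v f g.

(* A derivative of total order [K] moves [g] to exponents of this form. *)
Let E (K : nat) (t : 'cV[int]_n) := cons_col (s0 - (sumv t)%:~R - K%:R) (v + intv C t).

Lemma E_shift k a t : E (k + mdeg a) t + mnmv C (mcons k a) =
  cons_col (s0 - (sumv (t + mnmv int a))%:~R) (v + intv C (t + mnmv int a)).
Proof.
rewrite mnmv_mcons cons_colD intvD intv_mnmv addrA; congr cons_col.
by rewrite sumvD intrD sumv_mnmv natrD natz -[(Posz _)%:~R]/((mdeg a)%:R); ring.
Qed.

(** The k derivations d_0 contribute exactly the factors that carry [dpow_coef] from |t| + |a| to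
    |t| + K. The scalar thus depends only on t and the total order K, which lets the two sides of a
    binomial be compared. *)
Lemma dop_homogenization K k a t : (k + mdeg a)%N = K ->
  dop (mcons k a) g (E K t) = dpow_coef s0 (sumv t + K) * dop a f (v + intv C t).
Proof.
move=> <-; rewrite /dop E_shift ff_cons hom.1 [in RHS]PoszD (addrC (Posz k)) addrA.
have -> : sumv t + mdeg a = sumv (t + mnmv int a) by rewrite sumvD sumv_mnmv natz.
rewrite dpow_coefDn // intvD intv_mnmv !addrA.
by rewrite mulrACA [X in X * _]mulrC.
Qed.

Lemma dop_homogenization_supp k a s :
  dop (mcons k a) g s != 0 -> exists t, s = E (k + mdeg a) t.
Proof.
rewrite /dop mulf_eq0 negb_or => /andP[_ /hom.2[u e]].
exists (u - mnmv int a); apply: (addIr (mnmv C (mcons k a))).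
by rewrite e E_shift subrK.
Qed.

Lemma dop_supp a s : dop a f s != 0 -> exists t, s = v + intv C t.
Proof.
rewrite /dop mulf_eq0 negb_or => /andP[_ /f_supp[u e]].
exists (u - mnmv int a); apply: (addIr (mnmv C a)).
by rewrite e intvD intvN intv_mnmv -!addrA addNr addr0.
Qed.

Lemma homogenization_solution :
  solution (hypergeometric (rho_mx A) (cons_col beta0 beta)) g <->
  solution (hypergeometric A beta) f.
Proof.
rewrite !solution_hypergeometric; split=> [] [eul tor]; split.
- move=> s fs; have [u e] := f_supp fs.
  have /eul : g (cons_col (s0 - (sumv u)%:~R) (v + intv C u)) != 0.
    by rewrite hom.1 mulf_neq0 ?dpow_coef_neq0 // -e.
  by rewrite rho_mulE -e => /cons_col_inj[].
- move=> a b eab; apply/funext => s.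
  have [[t ->]|nt] := pselect (exists t, s = v + intv C t); last first.
    have z c : dop c f s = 0 by apply/eqP; apply: contraT => /dop_supp.
    by rewrite !z.
  (* Padding each monomial with d_0 to the power of the other's degree gives both the order
     [mdeg a + mdeg b]: the padded exponents have equal images under rho(A), and the two scalars
     agree. *)
  have /(congr1 (fun h : series C (1 + n) => h (E (mdeg a + mdeg b) t))) :
    dop (mcons (mdeg b) a) g = dop (mcons (mdeg a) b) g.
    apply: tor; rewrite !mnmv_mcons !rho_mulZE eab !sumv_mnmv; congr cons_col.
    by rewrite addrC.
  rewrite (dop_homogenization t (addnC _ _)) (dop_homogenization t erefl).
  by apply: mulfI; apply: dpow_coef_neq0.
- move=> s /[dup] gs /hom.2[u e]; move: gs; rewrite e rho_mulE hom.1.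
  rewrite mulf_eq0 negb_or => /andP[_ /eul ->]; congr cons_col.
  by rewrite sumvD sumv_intv; ring.
- move=> a b; rewrite -(mconsK a) -(mconsK b).
  move: (a _) (mtail a) (b _) (mtail b) => k {}a l {}b.
  rewrite !mnmv_mcons !rho_mulZE !sumv_mnmv => /cons_col_inj[edeg eab].
  (* The row of ones in rho(A) makes the two orders equal, so one exponent [E] serves both
     derivatives. *)
  have {}edeg : (k + mdeg a = l + mdeg b)%N by lia.
  apply/funext => s.
  have [[t ->]|nt] := pselect (exists t, s = E (k + mdeg a) t).
    rewrite (dop_homogenization t erefl) (dop_homogenization t (esym edeg)).
    by rewrite (tor a b eab).
  have z h c : (h + mdeg c = k + mdeg a)%N -> dop (mcons h c) g s = 0.
    by move=> e; apply/eqP; apply: contraT => /dop_homogenization_supp; rewrite e.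
  by rewrite !z.
Qed.

End HomogenizedSolutions.

(** * Initial ideals and initial exponents *)

Section Dotv.
Variables (R : realType) (n : nat).
Implicit Types (u v w : 'cV[R]_n) (m : 'X_{1..n}).

Lemma dotvC u v : dotv u v = dotv v u.
Proof. by apply: eq_bigr => i _; rewrite mulrC. Qed.

Lemma dotvDl u v w : dotv (u + v) w = dotv u w + dotv v w.
Proof. by rewrite /dotv -big_split; apply: eq_bigr => i _; rewrite mxE mulrDl. Qed.

Lemma dotvNl u w : dotv (- u) w = - dotv u w.
Proof. by rewrite /dotv -sumrN; apply: eq_bigr => i _; rewrite mxE mulNr. Qed.

Lemma dotvZl a u w : dotv (a *: u) w = a * dotv u w.
Proof. by rewrite /dotv mulr_sumr; apply: eq_bigr => i _; rewrite mxE mulrA. Qed.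

Lemma dotvv_gt0 u : u != 0 -> 0 < dotv u u.
Proof.
move=> u0; have [i ui] : exists i, u i 0 != 0.
  apply/existsP; apply: contraR u0; rewrite negb_exists => /forallP h.
  by apply/eqP/colP => i; rewrite mxE; apply/eqP; rewrite -[_ == _]negbK h.
rewrite /dotv (bigD1 i) //= ltr_pwDl -?expr2 ?exprn_even_gt0 //.
by apply: sumr_ge0 => j _; rewrite -expr2 sqr_ge0.
Qed.

Lemma positive_open k (a b : 'cV[R]_k) : (forall i, 0 < a i 0) ->
  exists2 eps, 0 < eps & forall i, 0 < (a + eps *: b) i 0.
Proof.
(* S exceeds every ratio |b_i| / a_i, so a step of length 1/S cannot use up any a_i. *)
move=> a0; pose S := 1 + \sum_i `|b i 0| / a i 0.
have t0 i : 0 <= `|b i 0| / a i 0 by rewrite divr_ge0 // ltW.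
have S0 : 0 < S by rewrite ltr_pwDl // sumr_ge0.
exists S^-1; rewrite ?invr_gt0 // => i.
rewrite !mxE -ltrBlDr sub0r.
apply: le_lt_trans (_ : S^-1 * `|b i 0| < _).
  by rewrite -mulrN ler_wpM2l ?invr_ge0 ?(ltW S0) // -normrN ler_norm.
rewrite mulrC ltr_pdivrMr // mulrC -ltr_pdivrMr // /S (bigD1 i) //= addrCA.
by rewrite ltrDl ltr_pwDl // sumr_ge0.
Qed.

Lemma cone_open X w e : strongly_convex_open_rational_cone X -> X w ->
  exists2 eps, 0 < eps & X (w + eps *: e).
Proof.
move=> [k [M [-> _]]] /= /(positive_open (map_mx intr M *m e))[eps eps0 h].
by exists eps => // i; rewrite mulmxDr -scalemxAr.
Qed.

(** If u were orthogonal to w, moving w slightly along -u would stay in the open cone and make the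
    product with u negative. *)
Lemma dual_cone_gt0 X w u : strongly_convex_open_rational_cone X -> X w ->
  dual_cone X u -> u != 0 -> 0 < dotv u w.
Proof.
move=> cX Xw dXu u0; rewrite lt_neqAle dXu // andbT eq_sym; apply/eqP => uw.
have [eps eps0 /dXu] := cone_open (- u) cX Xw.
rewrite dotvC dotvDl dotvC uw add0r dotvZl dotvNl mulrN oppr_ge0 leNgt.
by rewrite mulr_gt0 ?dotvv_gt0.
Qed.

End Dotv.

Section InitialForms.
Variables (R : realType) (n : nat).
Local Notation C := R[i].
Implicit Types (m : 'X_{1..n}) (p q c : {mpoly C[n]}) (w : 'cV[R]_n).

Lemma init_formE (wt : 'X_{1..n} -> R) p m :
  (init_form wt p)@_m =
  if all (fun m' => wt m' <= wt m) (msupp p) then p@_m else 0.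
Proof.
rewrite /init_form raddf_sum /=; under eq_bigr do rewrite mcoeffZ mcoeffX.
case: (boolP (m \in msupp p)) => mp; last first.
  rewrite (memN_msupp_eq0 mp) if_same big_seq_cond big1 // => m' /andP[m'p _].
  have [e|_] := eqVneq m' m; last by rewrite mulr0.
  by rewrite -e m'p in mp.
rewrite big_mkcond /= (bigD1_seq m) //= ?msupp_uniq // eqxx mulr1.
by rewrite big1 ?addr0 // => m' /negPf ->; rewrite mulr0 if_same.
Qed.

Lemma msupp_init_form (wt : 'X_{1..n} -> R) p m :
  m \in msupp (init_form wt p) ->
  m \in msupp p /\ (forall m', m' \in msupp p -> wt m' <= wt m).
Proof.
rewrite -[_ \in _]negbK -mcoeff_eq0 init_formE.
case: ifPn => [/allP h|_]; last by rewrite eqxx.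
by rewrite mcoeff_eq0 negbK.
Qed.

(** Distinct monomials send x^v to multiples of distinct powers, so this termwise condition
    expresses that p annihilates x^v. *)
Definition annihilated (v : 'cV[C]_n) p := forall m, m \in msupp p -> ff v m = 0.

Lemma annihilated_ideal v (S : set {mpoly C[n]}) :
  (forall p, S p -> annihilated v p) -> forall p, ideal_gen S p -> annihilated v p.
Proof.
move=> Sv; apply: ideal_gen_ind => [m|p q hp hq m|c p Sp m].
- by rewrite msupp0.
- by move/msuppD_le; rewrite mem_cat => /orP[/hp|/hq].
by move/msuppM_le/allpairsP => [[a b] /= [_ /(Sv _ Sp) h ->]]; rewrite ffD h mul0r.
Qed.

Lemma act_annihilated v p :
  annihilated v p -> act (weyl_of_dpoly p) (monomial_series v) = 0.
Proof.
move=> h; rewrite act_dpoly big_seq big1 // => m /h ffv.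
apply/funext => s; rewrite fctE /GRing.scale /= /dop /monomial_series.
by have [->|_] := eqVneq; rewrite ?ffv ?mul0r ?mulr0.
Qed.

Definition wdeg w m : R := dotv w (mnmv R m).

Lemma wdegD w m1 m2 : wdeg w (m1 + m2) = wdeg w m1 + wdeg w m2.
Proof. by rewrite /wdeg mnmvD dotvC dotvDl !(dotvC _ w). Qed.

(** The component of p of w-weight t, built with [mlin] so that linearity is at hand. *)
Definition hcomp w (t : R) p := mlin (fun m => if wdeg w m == t then 'X_[m] else 0) p.

Lemma hcompE w t p m : (hcomp w t p)@_m = if wdeg w m == t then p@_m else 0.
Proof.
rewrite /hcomp /mlin raddf_sum /=.
case: (boolP (m \in msupp p)) => mp; last first.
  rewrite (memN_msupp_eq0 mp) if_same big_seq big1 // => m' m'p; rewrite mcoeffZ.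
  have [e|ne] := eqVneq m' m; first by rewrite -e m'p in mp.
  by case: ifP => _; rewrite ?mcoeff0 ?mcoeffX ?(negPf ne) mulr0.
rewrite (bigD1_seq m) //= ?msupp_uniq // big1 ?addr0 => [|m' ne]; rewrite mcoeffZ.
  by case: ifP => _; rewrite ?mcoeff0 ?mcoeffX ?eqxx ?mulr1 ?mulr0.
by case: ifP => _; rewrite ?mcoeff0 ?mcoeffX ?(negPf ne) mulr0.
Qed.

Lemma hcomp_homog w t tau p : (forall m, m \in msupp p -> wdeg w m = tau) ->
  hcomp w t p = if tau == t then p else 0.
Proof.
move=> h; apply/mpolyP => m; rewrite hcompE.
case: (boolP (m \in msupp p)) => [/h ->|/memN_msupp_eq0 pm].
  by case: ifP => _; rewrite ?mcoeff0.
by rewrite pm if_same; case: ifP => _; rewrite ?mcoeff0.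
Qed.

Lemma hcompM w t tau c p : (forall m, m \in msupp p -> wdeg w m = tau) ->
  hcomp w t (c * p) = hcomp w (t - tau) c * p.
Proof.
move=> h; pose f c := hcomp w t (c * p); pose g c := hcomp w (t - tau) c * p.
suff : f =1 g by apply.
apply: mlin_ext => [a x y|a x y|m]; rewrite /f /g /hcomp.
- by rewrite mulrDl -scalerAl mlin_is_linear.
- by rewrite mlin_is_linear mulrDl -scalerAl.
rewrite mlinX -/(hcomp w t _) (@hcomp_homog _ _ (wdeg w m + tau)).
  by rewrite eq_sym -subr_eq eq_sym; case: ifP => _; rewrite ?mul0r.
move=> m' /msuppM_le /allpairsP[[a b] /= [+ /h <- ->]].
by rewrite msuppX inE => /eqP ->; rewrite wdegD.
Qed.

(** The generators are initial forms, hence w-homogeneous; multiplying by them only shifts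
    components, so the ideal is graded by w-weight. *)
Lemma init_ideal_hcomp w I t p :
  init_ideal w I p -> init_ideal w I (hcomp w t p).
Proof.
move: p; apply: ideal_gen_ind => [|p q hp hq|c s Ss].
- by rewrite /hcomp raddf0; exact: ideal_gen0.
- by rewrite /hcomp raddfD; exact: ideal_genD.
have [tau htau] : exists tau, forall m, m \in msupp s -> wdeg w m = tau.
  case: Ss => p _ <-; set s' := init_form _ _.
  have [->|[m ms]] : s' = 0 \/ exists m, m \in msupp s'.
  - have [->|] := eqVneq s' 0; [by left|right].
    by exists (mlead s'); rewrite mlead_supp.
  - by exists 0 => m; rewrite msupp0.
  exists (wdeg w m) => m' m's; apply/le_anti.
  have [mp mle] := msupp_init_form ms; have [m'p m'le] := msupp_init_form m's.
  by rewrite -!/(wdeg _ _) in mle m'le *; rewrite mle // m'le.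
by rewrite (hcompM _ _ htau); apply: ideal_genM; apply: ideal_gen_sub.
Qed.

(* Initial ideals that are constant near [w] are homogeneous for every weight
   near [w], and these weights separate monomials. *)
Lemma init_ideal_monomial (X : set 'cV[R]_n) w I p m :
  strongly_convex_open_rational_cone X -> X w ->
  (forall w', X w' -> init_ideal w I = init_ideal w' I) ->
  init_ideal w I p -> m \in msupp p -> init_ideal w I 'X_[m].
Proof.
move=> cX Xw stab; have [k] := ubnP (size (msupp p)); elim: k p => // k IH p.
rewrite ltnS => szp Ip mp.
have [/allP /= pm|/allPn[m' m'p /= nm]] := boolP (all (pred1 m) (msupp p)).
  have -> : 'X_[m] = (p@_m)^-1%:MP * p.
    rewrite mul_mpolyC; apply/mpolyP => m'; rewrite mcoeffZ mcoeffX.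
    have [<-|ne] := eqVneq m m'; first by rewrite mulVf // mcoeff_eq0 mp.
    rewrite (_ : p@_m' = 0) ?mulr0 //; apply: memN_msupp_eq0.
    by apply: contra ne => /pm; rewrite eq_sym.
  exact: ideal_genM.
(* If w itself does not separate m' from m, move it by eps * u with u = m' - m: the weight
   difference becomes eps times the positive number u . u. *)
have [w' Xw' sep] : exists2 w', X w' & wdeg w' m' != wdeg w' m.
  have [e|] := eqVneq (wdeg w m') (wdeg w m); last by exists w.
  pose u := mnmv R m' - mnmv R m.
  have u0 : u != 0.
    apply: contra nm; rewrite subr_eq0 => /eqP /colP emm; apply/eqP/mnmP => i.
    by have := emm i; rewrite !mxE => /eqP; rewrite eqr_nat => /eqP.
  have [eps eps0 Xw'] := cone_open u cX Xw; exists (w + eps *: u) => //.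
  rewrite /wdeg in e *; rewrite !(dotvDl w) e (inj_eq (addrI _)) -subr_eq0.
  rewrite !dotvZl -mulrBr !(dotvC u) -dotvNl -dotvDl.
  by rewrite mulf_neq0 // gt_eqF // dotvv_gt0.
have q_supp m1 : (m1 \in msupp (hcomp w' (wdeg w' m) p)) =
    (wdeg w' m1 == wdeg w' m) && (m1 \in msupp p).
  by rewrite !mcoeff_msupp hcompE; case: ifP; rewrite ?eqxx.
(* This component still contains m but has lost m'. It stays in the ideal because [stab] makes the
   ideal graded by w'-weight too. *)
apply: (IH (hcomp w' (wdeg w' m) p)).
- apply: leq_trans szp; apply: (@uniq_leq_size _ (m' :: _)).
    by rewrite /= msupp_uniq q_supp (negPf sep).
  by move=> m1; rewrite inE q_supp => /orP[/eqP ->|/andP[]].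
- by rewrite (stab _ Xw'); apply: init_ideal_hcomp; rewrite -(stab _ Xw').
- by rewrite q_supp eqxx.
Qed.

End InitialForms.

Section InitialExponents.
Variables (R : realType) (d n : nat) (A : 'M[int]_(d, n)).
Local Notation C := R[i].
Variables (beta : 'cV[C]_d) (w : 'cV[R]_n) (v : 'cV[C]_n).

Lemma fake_exponent_annihilated : map_mx intr A *m v = beta ->
  (forall p, init_ideal w (toric_ideal A) p -> annihilated v p) ->
  fake_exponent A beta w v.
Proof.
move=> Av ann; apply: solution_ideal_gen => P [[p Ip <-]|[i _ <-]].
  exact/act_annihilated/ann.
apply/funext => s; rewrite act_euler /monomial_series.
by have [->|_] := eqVneq; rewrite ?Av ?subrr ?mul0r ?mulr0.
Qed.

(** Let m be a monomial of maximal weight in p, and compare coefficients at x^(v - m) in p f = 0.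
    Only the starting term x^v contributes, so its falling factorial at m must vanish. *)
Lemma nilsson_annihilated f : logfree_basic_nilsson A beta w v f ->
  map_mx intr A *m v = beta /\
  (forall p, init_ideal w (toric_ideal A) p -> annihilated v p).
Proof.
move=> [[sol [X [U [[cX Xw _ _ _] dU suppf]]]] fv].
split; first by have [+ _] := (solution_hypergeometric A beta f).1 sol; apply.
apply: annihilated_ideal => _ [p [Ip _] <-] m /msupp_init_form[mp mmax].
have /(congr1 (fun g : series C n => g (v - mnmv C m))) : act (weyl_of_dpoly p) f = 0.
  by apply: sol; apply: ideal_gen_sub; left; exists p.
rewrite act_dpoly fct_sumE (bigD1_seq m) ?msupp_uniq //= big_seq_cond big1 ?addr0.
  rewrite fctE /GRing.scale /= /dop subrK => /eqP.
  by rewrite !mulf_eq0 (negPf fv) orbF mcoeff_eq0 mp /= => /eqP.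
(* A contribution from m' would put the nonzero vector m' - m in the dual cone, making m' strictly
   heavier than m. *)
move=> m' /andP[m'p ne]; rewrite fctE /GRing.scale /= /dop.
have [->|fs] := eqVneq (f (v - mnmv C m + mnmv C m')) 0; first by rewrite !mulr0.
have [u [Uu]] := suppf _ fs; rewrite -addrA => /addrI.
rewrite addrC -!(intv_mnmv C) -intvN -intvD => /intv_inj eu.
have [dXu _] := dU _ Uu; move: (mmax _ m'p); rewrite leNgt => /negP[].
have u0 : intv R u != 0.
  apply: contra ne => /eqP; rewrite -(intv0 R n) => /intv_inj; rewrite -eu.
  move=> /eqP; rewrite subr_eq0 => /eqP /colP e.
  by apply/eqP/mnmP => i; have := e i; rewrite !mxE !natz => -[].
have := dual_cone_gt0 cX Xw dXu u0.
by rewrite -eu intvD intvN !intv_mnmv dotvDl dotvNl subr_gt0 !(dotvC _ w).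
Qed.

End InitialExponents.

(** * Standard pairs through a given exponent *)

Section Dickson.
Variable n : nat.
Implicit Types (u v : 'X_{1..n}) (I : set 'X_{1..n}).

Definition up_closed I := forall u v, (u <= v)%MM -> I u -> I v.

Definition mtrunc K u : 'X_{1..n} := [multinom minn (u i) K | i < n].

(** Dickson's lemma by induction on the coordinates allowed to be nonzero: [T] lists them, and one
    coordinate is split off at a time. *)
Lemma dickson_support (T : seq 'I_n) I : up_closed I ->
  exists K, forall u, (forall i, i \notin T -> u i = 0%N) -> I u -> I (mtrunc K u).
Proof.
elim: T I => [|i T IH] I upI.
  exists 0%N => u u0 Iu; rewrite (_ : mtrunc 0 u = u) //.
  by apply/mnmP => j; rewrite mnmE u0.
pose add k u : 'X_{1..n} := [multinom u j + (i == j) * k | j < n].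
have add_le k l u v : (u <= v)%MM -> (k <= l)%N -> (add k u <= add l v)%MM.
  move=> /mnm_lepP uv kl; apply/mnm_lepP => j; rewrite !mnmE leq_add //.
  by rewrite leq_mul2l kl orbT.
(* [Kinf] serves the projection of I that forgets coordinate i; below, [Kf k] serves the slice of I
   at height k in that coordinate. *)
have [Kinf hKinf] : exists K, forall u, (forall j, j \notin T -> u j = 0%N) ->
    (exists k, I (add k u)) -> exists k, I (add k (mtrunc K u)).
  apply: (IH [set u | exists k, I (add k u)]) => u v uv [k Ik].
  by exists k; apply: upI Ik; apply: add_le.
have /choice[Kf hKf] : forall k, exists K, forall u,
    (forall j, j \notin T -> u j = 0%N) -> I (add k u) -> I (add k (mtrunc K u)).
  move=> k; apply: (IH [set u | I (add k u)]) => u v uv.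
  by apply: upI; apply: add_le.
pose mon (c : {ffun 'I_n -> 'I_Kinf.+1}) : 'X_{1..n} := [multinom val (c j) | j < n].
(* For each of the finitely many points of the box, [kf] is a height in coordinate i at which the
   point lies in I, with dummy value 0 if there is none; [ks] bounds these heights. *)
have /choice[kf hkf] : forall c, exists l, (exists k, I (add k (mon c))) ->
    I (add l (mon c)).
  move=> c; have [[k Ik]|nk] := pselect (exists k, I (add k (mon c))).
    by exists k.
  by exists 0%N.
pose ks := \max_c kf c.
(* If u_i >= ks, truncating the other coordinates at [Kinf] gives a point of I of height at most ks,
   below the truncation of u. If u_i < ks, the bound for the slice at height u_i applies. *)
exists (maxn ks (maxn Kinf (\max_(k < ks) Kf k))) => u u0 Iu; set K := maxn _ _.
pose u' : 'X_{1..n} := [multinom if i == j then 0%N else u j | j < n].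
have u'0 j : j \notin T -> u' j = 0%N.
  by move=> jT; rewrite mnmE; case: eqVneq => // ij; rewrite u0 // inE negb_or eq_sym ij.
have eu : add (u i) u' = u.
  by apply/mnmP => j; rewrite !mnmE; case: eqVneq => [->|_]; rewrite ?mul1n ?addn0.
have [kui|uik] := leqP ks (u i).
  have [k Ik] : exists k, I (add k (mtrunc Kinf u')).
    by apply: hKinf => //; exists (u i); rewrite eu.
  pose c : {ffun 'I_n -> 'I_Kinf.+1} := [ffun j => inord (mtrunc Kinf u' j)].
  have ec : mon c = mtrunc Kinf u'.
    by apply/mnmP => j; rewrite [LHS]mnmE ffunE /= inordK // ltnS mnmE geq_minr.
  have Ic : I (add (kf c) (mon c)) by apply: hkf; exists k; rewrite ec.
  apply: upI Ic; apply/mnm_lepP => j; rewrite ec !mnmE.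
  case: eqVneq => [<-|ij]; last first.
    by rewrite mul0n addn0 leq_min geq_minl geq_min !leq_max leqnn !orbT.
  have : (kf c <= ks)%N by exact: leq_bigmax.
  by rewrite min0n mul1n add0n leq_min /K => h; rewrite (leq_trans h kui) leq_max h.
have : I (add (u i) (mtrunc (Kf (u i)) u')) by apply: hKf => //; rewrite eu.
apply: upI; apply/mnm_lepP => j; rewrite !mnmE.
case: eqVneq => [<-|ij].
  by rewrite min0n mul1n add0n leq_min leqnn /K leq_max (ltnW uik).
rewrite mul0n addn0 leq_min geq_minl geq_min !leq_max.
by rewrite (@leq_bigmax _ (fun k : 'I_ks => Kf k) (Ordinal uik)) !orbT.
Qed.

(** With upward closure this says that I is determined by its members in a finite box, a form of
    Dickson's lemma suited to building the finite cover of standard exponents. *)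
Lemma dickson I : up_closed I -> exists K, forall u, I u -> I (mtrunc K u).
Proof.
move=> /(dickson_support (enum 'I_n))[K hK]; exists K => u; apply: hK => i.
by rewrite mem_enum.
Qed.

End Dickson.

(** * Zariski closures of translated coordinate subspaces and their lattice points *)

Section Zariski.
Variables (R : realType) (n : nat).
Local Notation C := R[i].
Implicit Types (X Y Z : set 'cV[C]_n) (p : {mpoly C[n]}) (a b z : 'cV[C]_n).
Implicit Types (L : seq ('X_{1..n} * {set 'I_n})).
Local Notation ev p z := (p.@[fun i => z i 0]).

Definition line_poly p a b : {poly C} :=
  mmap polyC (fun i => (a i 0)%:P + (b i 0) *: 'X) p.

Lemma line_polyE p a b t : (line_poly p a b).[t] = ev p (a + t *: b).
Proof.
rewrite /line_poly /mmap horner_sum mevalE; apply: eq_bigr => m _.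
rewrite hornerM hornerC /mmap1 horner_prod; congr (_ * _).
apply: eq_bigr => i _; rewrite horner_exp hornerD hornerC hornerZ hornerX.
by rewrite !mxE mulrC.
Qed.

Lemma poly_nat_roots (q : {poly C}) : (forall k : nat, q.[k%:R] = 0) -> q = 0.
Proof.
move=> h; apply/eqP; apply: contraT => q0.
pose rs : seq C := [seq k%:R | k <- iota 0 (size q)].
have : (size rs < size q)%N.
  apply: max_poly_roots q0 _ _.
    by apply/allP => _ /mapP[k _ ->]; apply/eqP/h.
  rewrite map_inj_uniq ?iota_uniq // => k l /eqP; by rewrite eqr_nat => /eqP.
by rewrite size_map size_iota ltnn.
Qed.

Lemma zariski_closure_mono X Y : X `<=` Y -> zariski_closure X `<=` zariski_closure Y.
Proof. by move=> XY z hz p hp; apply: hz => x /XY; apply: hp. Qed.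

Lemma sub_zariski_closure X : X `<=` zariski_closure X.
Proof. by move=> x Xx p; apply. Qed.

Lemma zariski_closed_sep X z : zariski_closed X -> ~ X z ->
  exists2 p, (forall x, X x -> ev p x = 0) & ev p z != 0.
Proof.
move=> cX nXz; apply: contrapT => h; apply: nXz; rewrite -cX => p hp.
by apply/eqP; apply: contraT => pz; case: h; exists p.
Qed.

Lemma zariski_closedU X Y : zariski_closed X -> zariski_closed Y ->
  zariski_closed (X `|` Y).
Proof.
move=> cX cY; apply/seteqP; split; last exact: sub_zariski_closure.
move=> z hz; apply: contrapT => /not_orP[nX nY].
have [p hp pz] := zariski_closed_sep cX nX; have [q hq qz] := zariski_closed_sep cY nY.
have /eqP : ev (p * q) z = 0.
  by apply: hz => x [/hp|/hq] e; rewrite mevalM e ?mul0r ?mulr0.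
by rewrite mevalM mulf_eq0 (negPf pz) (negPf qz).
Qed.

Lemma alpha_plus_closed (alpha : 'X_{1..n}) sigma :
  zariski_closed (@alpha_plus R n alpha sigma).
Proof.
apply/seteqP; split; last exact: sub_zariski_closure.
move=> z hz i is_; have := hz ('X_i - (alpha i)%:R%:MP).
rewrite mevalB mevalXU mevalC => h; apply/eqP; rewrite -subr_eq0 h //.
by move=> x xs; rewrite mevalB mevalXU mevalC (xs i is_) subrr.
Qed.

(** Restrict the two separating polynomials to the line through a and b, which stays in the set.
    Their product vanishes at all natural parameters, hence is zero; yet one factor is nonzero at 0
    and the other at 1. *)
Lemma alpha_plus_irreducible (alpha : 'X_{1..n}) sigma :
  zariski_irreducible (@alpha_plus R n alpha sigma).
Proof.
split; first by exists (mnmv C alpha) => i _; rewrite mxE.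
move=> Y Z cY cZ XYZ; apply: contrapT => /not_orP[nY nZ].
have [a Xa nYa] : exists2 a, alpha_plus alpha sigma a & ~ Y a.
  by apply: contrapT => h; apply: nY => a Xa; apply: contrapT => nYa; apply: h; exists a.
have [b Xb nZb] : exists2 b, alpha_plus alpha sigma b & ~ Z b.
  by apply: contrapT => h; apply: nZ => b Xb; apply: contrapT => nZb; apply: h; exists b.
have [p hp pa] := zariski_closed_sep cY nYa; have [q hq qb] := zariski_closed_sep cZ nZb.
have : line_poly p a (b - a) * line_poly q a (b - a) = 0.
  apply: poly_nat_roots => k; rewrite hornerM !line_polyE.
  have : alpha_plus alpha sigma (a + k%:R *: (b - a)).
    by move=> i is_; rewrite !mxE Xa // Xb // subrr mulr0 addr0.
  by move=> /XYZ[/hp|/hq] ->; rewrite ?mul0r ?mulr0.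
move/eqP; rewrite mulf_eq0 => /orP[] /eqP e.
  have ea : a = a + 0 *: (b - a) by rewrite scale0r addr0.
  by move: pa; rewrite ea -line_polyE e horner0 eqxx.
have eb : b = a + 1 *: (b - a) by rewrite scale1r addrC subrK.
by move: qb; rewrite eb -line_polyE e horner0 eqxx.
Qed.

Definition alpha_union L : set 'cV[C]_n :=
  [set z | exists2 x, x \in L & alpha_plus x.1 x.2 z].

Lemma alpha_union_cons x L : alpha_union (x :: L) = alpha_plus x.1 x.2 `|` alpha_union L.
Proof.
apply/seteqP; split=> [z [y]|z [xz|[y yL yz]]].
- by rewrite inE => /orP[/eqP ->|yL yz]; [left|right; exists y].
- by exists x => //; rewrite mem_head.
- by exists y => //; rewrite inE yL orbT.
Qed.

Lemma alpha_union_closed L : zariski_closed (alpha_union L).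
Proof.
elim: L => [|x L IH].
  apply/seteqP; split; last exact: sub_zariski_closure.
  move=> z hz; have /eqP : ev 1 z = 0 by apply: hz => x [].
  by rewrite meval1 oner_eq0.
by rewrite alpha_union_cons; apply: zariski_closedU => //; apply: alpha_plus_closed.
Qed.

Lemma irreducible_alpha_union Y L : zariski_irreducible Y -> Y `<=` alpha_union L ->
  exists2 x, x \in L & Y `<=` alpha_plus x.1 x.2.
Proof.
move=> [[y Yy] irr]; elim: L => [/(_ y Yy)[]//|x L IH]; rewrite alpha_union_cons.
move=> /(irr _ _ (@alpha_plus_closed _ _) (@alpha_union_closed L))[|/IH[x' x'L]].
  by exists x => //; rewrite mem_head.
by exists x' => //; rewrite inE x'L orbT.
Qed.

(** The coordinates in sigma are freed one at a time: along a single coordinate, a polynomial that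
    vanishes at all natural numbers is zero. *)
Lemma alpha_plus_lattice_dense (alpha : 'X_{1..n}) sigma :
  alpha_plus alpha sigma `<=`
  zariski_closure [set mnmv C u | u in [set u | alpha_plus alpha sigma (mnmv C u)]].
Proof.
move=> z hz p hp.
suff H (T : seq 'I_n) : (forall i, i \in T -> i \in sigma) -> forall x, alpha_plus alpha sigma x ->
    (forall i, i \notin T -> exists k : nat, x i 0 = k%:R) -> ev p x = 0.
  apply: (H (enum sigma) _ z hz) => i; rewrite mem_enum // => is_.
  by exists (alpha i); rewrite hz.
elim: T => [|i T IH] Ts x xs xn.
  have [k hk] := choice (fun i => xn i isT).
  have ex : mnmv C [multinom k i | i < n] = x.
    by apply/colP => i; rewrite !mxE mnmE hk.
  by apply: hp; exists [multinom k i | i < n] => //=; rewrite ex.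
pose a : 'cV[C]_n := \col_j (if j == i then 0 else x j 0).
have ex : x = a + x i 0 *: delta_mx i 0.
  apply/colP => j; rewrite !mxE eqxx andbT.
  by case: eqVneq => [->|_]; rewrite ?mulr1 ?add0r ?mulr0 ?addr0.
rewrite ex -line_polyE (_ : line_poly _ _ _ = 0) ?horner0 //.
apply: poly_nat_roots => k; rewrite line_polyE; apply: IH.
- by move=> j jT; apply: Ts; rewrite inE jT orbT.
- move=> j js; rewrite !mxE eqxx andbT; case: eqVneq => [ji|_].
    by move: js; rewrite ji Ts // mem_head.
  by rewrite mulr0 addr0 xs.
- move=> j jT; rewrite !mxE eqxx andbT; case: eqVneq => [_|ji].
    by exists k; rewrite mulr1 add0r.
  by rewrite mulr0 addr0; apply: xn; rewrite inE negb_or ji.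
Qed.

End Zariski.

(** * Existence of a standard pair through an annihilated exponent *)

Section StandardPairExistence.
Variables (R : realType) (n : nat) (I : set {mpoly R[i][n]}).
Local Notation C := R[i].
Hypothesis I_ideal : forall c p, I p -> I (c * p).

Lemma monomials_up_closed : up_closed [set u | I 'X_[u]].
Proof.
by move=> u v uv; rewrite /= -(submK uv) mpolyXD; apply: I_ideal.
Qed.

(** By Dickson, membership in I depends only on the exponent truncated at K. Each standard point of
    the box thus yields a piece along which its coordinates equal to K move freely. *)
Lemma staircase_cover : exists L : seq ('X_{1..n} * {set 'I_n}),
  (forall u, ~ I 'X_[u] -> alpha_union L (mnmv C u)) /\
  (forall x, x \in L -> forall b, alpha_plus x.1 x.2 (mnmv C b) -> ~ I 'X_[b]).
Proof.
have [K hK] := dickson monomials_up_closed.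
pose mon (c : {ffun 'I_n -> 'I_K.+1}) : 'X_{1..n} := [multinom val (c j) | j < n].
pose tau c : {set 'I_n} := [set i | mon c i == K]%SET.
exists [seq (mon c, tau c) | c <- enum {: {ffun 'I_n -> 'I_K.+1}} & `[< ~ I 'X_[mon c] >]].
split=> [u nIu|x /mapP[c]].
  pose c : {ffun 'I_n -> 'I_K.+1} := [ffun i => inord (mtrunc K u i)].
  have ec : mon c = mtrunc K u.
    by apply/mnmP => j; rewrite [LHS]mnmE ffunE /= inordK // ltnS mnmE geq_minr.
  exists (mon c, tau c) => /=.
    apply: map_f; rewrite mem_filter mem_enum andbT; apply/asboolP; rewrite ec.
    move=> h; apply: nIu; apply: monomials_up_closed h.
    by apply/mnm_lepP => j; rewrite mnmE geq_minl.
  move=> i; rewrite inE ec !mxE mnmE; case: (leqP (u i) K) => //.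
  by rewrite eqxx.
rewrite mem_filter => /andP[/asboolP nIc _] -> b /= hb /hK h; apply: nIc.
apply: monomials_up_closed h; apply/mnm_lepP => i; rewrite mnmE.
case: (boolP (i \in tau c)) => [|/hb]; first by rewrite inE => /eqP ->; rewrite geq_minr.
by rewrite !mxE => /eqP; rewrite eqr_nat => /eqP ->; rewrite geq_minl.
Qed.

(** Take sigma maximal such that v is natural off sigma and all lattice points agreeing with v there
    are standard. An irreducible set between the resulting piece and the closure lies in one piece
    of [staircase_cover], and maximality forces the two pieces to coincide. *)
Lemma standard_pair_exists (v : 'cV[C]_n) : (forall m, I 'X_[m] -> ff v m = 0) ->
  exists alpha sigma, standard_pair I alpha sigma /\ alpha_plus alpha sigma v.
Proof.
move=> hv.
pose P (s : {set 'I_n}) := (forall i, i \notin s -> exists k : nat, v i 0 = k%:R) /\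
  (forall b : 'X_{1..n}, (forall i, i \notin s -> (b i)%:R = v i 0) -> ~ I 'X_[b]).
pose Q := [pred s | `[< P s >]].
(* Start from the coordinates where v is not natural. This set satisfies P: if d^b were in I, then
   [ff v b] would vanish, so v_i = k < b_i for some i; but such an i is off the set, where b_i =
   v_i. *)
have [sigma /maxsetP[/asboolP[vn vS] smax] _] :
    {s | maxset Q s & [set i | `[< ~ exists k : nat, v i 0 = k%:R >]]%SET \subset s}.
  apply: maxset_exists; apply/asboolP; split=> [i|b hb /hv /ff_eq0[i [k [kb e]]]].
    by rewrite inE => /asboolP /contrapT.
  have := hb i; rewrite e inE => h; move: kb; rewrite ltnNge => /negP; apply.
  suff /eqP : (b i)%:R = k%:R :> C by rewrite eqr_nat => /eqP ->.
  by apply: h; apply/asboolPn => h; apply: h; exists k.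
have /choice[k hk] : forall i, exists k : nat, i \notin sigma -> v i 0 = k%:R.
  move=> i; have [is_|/vn[k hk]] := boolP (i \in sigma); first by exists 0%N.
  by exists k.
pose alpha : 'X_{1..n} := [multinom if i \in sigma then 0%N else k i | i < n].
have va : alpha_plus alpha sigma v by move=> i is_; rewrite mnmE (negPf is_) hk.
exists alpha, sigma; split=> //; split; last first.
  move=> b hb i; rewrite mnmE; case: ifPn => // is_.
  by have := hb i is_; rewrite !mxE mnmE (negPf is_) => /eqP; rewrite eqr_nat => /eqP ->.
split; [|exact: alpha_plus_irreducible|move=> Y irrY YS aY].
  apply: subset_trans (@alpha_plus_lattice_dense _ _ _ _) _.
  apply: zariski_closure_mono => _ [u us <-]; exists u => //.
  by apply: vS => i is_; rewrite va // -us // mxE.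
have [L [cover LS]] := staircase_cover.
have YL : Y `<=` alpha_union L.
  apply: subset_trans YS _; rewrite -[X in _ `<=` X]alpha_union_closed.
  by apply: zariski_closure_mono => _ [u us <-]; apply: cover.
have [[c tau] xL /= Ytau] := irreducible_alpha_union irrY YL.
have atau (z : 'cV[C]_n) : alpha_plus alpha sigma z -> alpha_plus c tau z by move=> /aY /Ytau.
have st : sigma \subset tau.
  apply/fintype.subsetP => i is_; apply: contraT => it.
  have p0 : alpha_plus alpha sigma (mnmv C alpha + delta_mx i 0).
    move=> j js; rewrite !mxE eqxx andbT (_ : j == i = false) ?addr0 //.
    by apply: contraNF js => /eqP ->.
  have p1 : alpha_plus alpha sigma (mnmv C alpha) by move=> j _; rewrite mxE.
  have := atau _ p0 i it; rewrite -(atau _ p1 i it) !mxE !eqxx /= => /eqP.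
  by rewrite -[X in _ == X]addr0 (inj_eq (addrI _)) oner_eq0.
have vtau := atau _ va.
(* tau also satisfies P, since all lattice points of a piece of the cover are standard and v lies on
   this piece. *)
have et : tau = sigma.
  apply: smax st; apply/asboolP; split=> [i it|b hb]; first by exists (c i); exact: vtau.
  by apply: (LS _ xL) => i it; rewrite mxE hb // vtau.
apply/seteqP; split=> // z /Ytau; rewrite et => hz i is_.
by rewrite hz // -va // vtau ?et.
Qed.

End StandardPairExistence.

(** * Passing between A and rho(A) *)

Section HomogenizedIdeal.
Variables (R : realType) (d n : nat) (A : 'M[int]_(d, n)) (w : 'cV[R]_n).
Local Notation C := R[i].
Implicit Types (m a b : 'X_{1..n}) (p q : {mpoly C[n]}).
Local Notation I := (@toric_ideal R d n A).
Local Notation Irho := (@toric_ideal R (1 + d) (1 + n) (rho_mx A)).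
Local Notation J := (init_ideal (cons_col 0 w) Irho).

(** Homogenization of p to degree K by powers of d_0. The subtraction is truncated, so this is
    homogeneous only when K bounds the degrees in p. *)
Definition hpoly K p : {mpoly C[1 + n]} := mlin (fun m => 'X_[mcons (K - mdeg m) m]) p.

Lemma hpolyE K p k m :
  (hpoly K p)@_(mcons k m) = if k == (K - mdeg m)%N then p@_m else 0.
Proof.
rewrite /hpoly /mlin raddf_sum /=; under eq_bigr do rewrite mcoeffZ mcoeffX.
have e m' : (mcons (K - mdeg m') m' == mcons k m) = (k == K - mdeg m)%N && (m' == m).
  apply/eqP/andP => [/mcons_inj[<- ->]|[/eqP -> /eqP -> //]].
  by rewrite !eqxx.
under eq_bigr do rewrite e.
case: ifP => _; last by rewrite big1 // => m' _; rewrite mulr0.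
case: (boolP (m \in msupp p)) => mp.
  rewrite (bigD1_seq m) ?msupp_uniq //= eqxx mulr1 big1 ?addr0 // => m' /negPf ->.
  by rewrite mulr0.
rewrite (memN_msupp_eq0 mp) big_seq big1 // => m' m'p.
by case: eqVneq => [e'|_]; rewrite ?mulr0 //; rewrite -e' m'p in mp.
Qed.

Lemma msupp_hpoly K p k m : mcons k m \in msupp (hpoly K p) =
  (k == K - mdeg m)%N && (m \in msupp p).
Proof. by rewrite !mcoeff_msupp hpolyE; case: ifP; rewrite ?eqxx. Qed.

(** The bound comes from an expression of p by binomials, whose degrees may exceed that of p through
    cancellation; each binomial homogenizes to a binomial of the larger toric ideal. *)
Lemma hpoly_toric p : I p -> exists K0, forall K, (K0 <= K)%N -> Irho (hpoly K p).
Proof.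
move: p; apply: toric_ideal_ind => [|p q [K1 h1] [K2 h2]|c a b eab].
- by exists 0%N => K _; rewrite /hpoly raddf0; exact: ideal_gen0.
- exists (maxn K1 K2) => K; rewrite geq_max => /andP[/h1 hp /h2 hq].
  by rewrite /hpoly raddfD; exact: ideal_genD.
exists (maxn (mdeg a) (mdeg b)) => K; rewrite geq_max => /andP[aK bK].
rewrite /hpoly linearZ raddfB /= !mlinX; apply: toric_idealZ; apply: toric_idealB.
rewrite !mnmv_mcons !rho_mulZE !sumv_mnmv eab; congr cons_col.
by rewrite -!natrD !subnK.
Qed.

Lemma wdeg_mcons k m : wdeg (cons_col 0 w) (mcons k m) = wdeg w m.
Proof.
rewrite /wdeg mnmv_mcons /dotv big_split_ord big_ord1 /= !cons_col_l mul0r add0r.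
by apply: eq_bigr => i _; rewrite !cons_col_r.
Qed.

Lemma msupp_init_hpoly K p m : m \in msupp (init_form (wdeg w) p) ->
  mcons (K - mdeg m) m \in msupp (init_form (wdeg (cons_col 0 w)) (hpoly K p)).
Proof.
move=> /msupp_init_form[mp mmax].
rewrite mcoeff_msupp init_formE ifT; first by rewrite -mcoeff_msupp msupp_hpoly eqxx.
apply/allP => M; rewrite -(mconsK M) msupp_hpoly => /andP[_ Mp].
by rewrite !wdeg_mcons mmax.
Qed.

(** The falling factorial as a polynomial in the exponent, so that its vanishing passes to Zariski
    closures. *)
Definition ff_poly k (m : 'X_{1..k}) : {mpoly C[k]} :=
  \prod_(i < k) \prod_(j < m i) ('X_i - (j%:R)%:MP).

Lemma ff_polyE k (m : 'X_{1..k}) (z : 'cV[C]_k) : (ff_poly m).@[fun i => z i 0] = ff z m.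
Proof.
rewrite /ff_poly rmorph_prod; apply: eq_bigr => i _ /=.
by rewrite rmorph_prod; apply: eq_bigr => j _ /=; rewrite mevalB mevalXU mevalC.
Qed.

(** At a natural exponent u the falling factorial is nonzero only if m <= u, which would put d^u in
    K. So it vanishes on the standard exponents, hence on their closure, which contains the pair. *)
Lemma standard_pair_ff k (K : set {mpoly C[k]}) alpha sigma
    (z : 'cV[C]_k) (m : 'X_{1..k}) :
  (forall c (p : {mpoly C[k]}), K p -> K (c * p)) -> standard_pair K alpha sigma ->
  alpha_plus alpha sigma z -> K 'X_[m] -> ff z m = 0.
Proof.
move=> Kid [[sub _ _] _] /sub + Km => /(_ (ff_poly m)); rewrite ff_polyE; apply.
move=> _ [u nKu <-]; rewrite ff_polyE; apply/eqP; apply: contraT => /ff_mnmv mu.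
case: nKu; rewrite -(submK mu) mpolyXD; exact: Kid.
Qed.

(* Along a standard pair through zero the exponent of x_0 is free: at -1 it is
   annihilated by no power of the derivation d_0, so the other factor vanishes. *)
Lemma pass_zero_annihilated X alpha sigma v0 (v : 'cV[C]_n) :
  strongly_convex_open_rational_cone X -> X (cons_col 0 w) ->
  (forall w', X w' -> J = init_ideal w' Irho) ->
  standard_pair J alpha sigma -> alpha_plus alpha sigma (cons_col v0 v) ->
  lshift n ord0 \in sigma ->
  forall p, init_ideal w I p -> annihilated v p.
Proof.
move=> cX Xw stab sp av s0; apply: annihilated_ideal => _ [p [Ip p0] <-] m mp.
have [K0 /(_ K0 (leqnn _)) Ih] := hpoly_toric Ip.
have JM : J 'X_[mcons (K0 - mdeg m) m].
  apply: (init_ideal_monomial cX Xw stab _ (msupp_init_hpoly K0 mp)).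
  apply: ideal_gen_sub; exists (hpoly K0 p) => //; split=> //.
  have [mp' _] := msupp_init_form mp.
  have : mcons (K0 - mdeg m) m \in msupp (hpoly K0 p) by rewrite msupp_hpoly eqxx.
  by apply: contraTneq => ->; rewrite msupp0.
have Jid c (q : {mpoly C[1 + n]}) : J q -> J (c * q) by exact: ideal_genM.
have av' : alpha_plus alpha sigma (cons_col (-1) v).
  move=> i is_; rewrite -av // -(splitK i); case E : (fintype.split i) => [j|j] /=.
    have ei : i = lshift n ord0 by rewrite -(splitK i) E /= (ord1 j).
    by move: is_; rewrite ei s0.
  by rewrite !cons_col_r.
have /eqP := standard_pair_ff Jid sp av' JM; rewrite ff_cons mulf_eq0.
case/orP => [|/eqP //]; rewrite prodf_seq_eq0 => /hasP[j _] /=.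
by rewrite -opprD oppr_eq0 -(natrD _ 1) pnatr_eq0.
Qed.

End HomogenizedIdeal.

(** * Pulling cones back between the two weight spaces *)

Section Cones.
Variable R : realType.

(** Stacking the facet normals M and N L describes the intersection; strong convexity is inherited
    from X. *)
Lemma cone_preimage m k (X : set 'cV[R]_m) (Y : set 'cV[R]_k) (L : 'M[int]_(k, m)) :
  strongly_convex_open_rational_cone X -> strongly_convex_open_rational_cone Y ->
  strongly_convex_open_rational_cone [set w | X w /\ Y (map_mx intr L *m w)].
Proof.
move=> [r [M [-> scM]]] [s [N [-> _]]]; exists (r + s)%N, (col_mx M (N *m L)).
have e (u : 'cV[R]_m) : map_mx intr (col_mx M (N *m L)) *m u =
    col_mx (map_mx intr M *m u) (map_mx intr N *m (map_mx intr L *m u)).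
  by rewrite map_col_mx mul_col_mx map_mxM mulmxA.
split=> [|u u0 u1].
  apply/seteqP; split=> [u [/= h1 h2] i|u /= h].
    rewrite e -(splitK i); case: (fintype.split i) => j /=.
      by rewrite col_mxEu.
    by rewrite col_mxEd.
  split=> i; first by have := h (lshift s i); rewrite e col_mxEu.
  by have := h (rshift r i); rewrite e col_mxEd.
apply: scM => i.
  by have := u0 (lshift s i); rewrite e col_mxEu.
by have := u1 (lshift s i); rewrite e col_mxEu.
Qed.

Variable n : nat.

(** Subtracts the weight of x_0 from all the others: the transpose of u |-> (-|u|, u), which
    identifies the kernel of A with that of rho(A). *)
Definition dehom_mx : 'M[int]_(n, 1 + n) := row_mx (- const_mx 1) 1%:M.
Definition incl_mx : 'M[int]_(1 + n, n) := col_mx 0 1%:M.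

Lemma incl_mxE (w : 'cV[R]_n) : map_mx intr incl_mx *m w = cons_col 0 w.
Proof.
rewrite map_col_mx map_mx0 map_mx1 mul_col_mx mul0mx mul1mx.
by apply: cons_colP => [|i]; rewrite ?col_mxEu ?col_mxEd ?mxE.
Qed.

Lemma dehom_mxE x (w : 'cV[R]_n) :
  map_mx intr dehom_mx *m cons_col x w = w - const_mx x.
Proof.
rewrite map_row_mx map_mx1 mul_row_col mul1mx addrC; congr (_ + _).
by apply/colP => i; rewrite !mxE big_ord1 !mxE eqxx mulr1n mulrNz mulN1r.
Qed.

Lemma dotv_cons x y (u w : 'cV[R]_n) :
  dotv (cons_col x u) (cons_col y w) = x * y + dotv u w.
Proof.
rewrite /dotv big_split_ord big_ord1 /= !cons_col_l; congr (_ + _).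
by apply: eq_bigr => i _; rewrite !cons_col_r.
Qed.

Lemma dotv_dehom (u : 'cV[int]_n) (w : 'cV[R]_(1 + n)) :
  dotv (intv R (cons_col (- sumv u) u)) w = dotv (intv R u) (map_mx intr dehom_mx *m w).
Proof.
have -> : w = cons_col (w (lshift n ord0) 0) (dsubmx w).
  by apply: cons_colP => [|i]; rewrite ?mxE.
rewrite intv_cons dotv_cons dehom_mxE dotvC [in RHS]dotvC dotvDl addrC; congr (_ + _).
rewrite dotvC /dotv mulrNz mulNr -sumv_intv /sumv mulr_suml -sumrN.
by apply: eq_bigr => i _; rewrite !mxE mulrN.
Qed.

End Cones.

(** * Transfer of basic Nilsson series in both directions *)

Section HomogenizedNilsson.
Variables (R : realType) (d n : nat) (A : 'M[int]_(d, n)).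
Local Notation C := R[i].
Variables (beta : 'cV[C]_d) (w : 'cV[R]_n) (beta0 : C).
Local Notation rbeta := (cons_col beta0 beta).
Local Notation rw := (cons_col 0 w).

Lemma rho_ones : ones_in_row_span (rho_mx A).
Proof.
exists (row_mx 1%:M 0); rewrite map_block_mx mul_row_block !mul1mx !mul0mx !addr0.
rewrite map_mx1; apply/rowP => i; rewrite -(splitK i).
case: (fintype.split i) => j /=; rewrite ?row_mxEl ?row_mxEr !mxE //.
by rewrite (ord1 j).
Qed.

Lemma rho_ker (u : 'cV[int]_(1 + n)) : rho_mx A *m u = 0 ->
  exists2 u', A *m u' = 0 & u = cons_col (- sumv u') u'.
Proof.
have -> : u = cons_col (u (lshift n ord0) 0) (dsubmx u).
  by apply: cons_colP => [|i]; rewrite ?mxE.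
move: (u _ _) (dsubmx u) => x a.
have -> : 0 = cons_col 0 0 :> 'cV[int]_(1 + d).
  by apply: cons_colP => [|i]; rewrite !mxE.
rewrite rho_mulZE => /cons_col_inj[/eqP]; rewrite addr_eq0 => /eqP -> Aa.
by exists a.
Qed.

(** Dehomogenize by dividing by the coefficients [dpow_coef], which are nonzero because beta0 - |v|
    is not an integer. *)
Lemma homogenization_exists (v : 'cV[C]_n) (g : series C (1 + n)) :
  ~ is_integer (beta0 - sumv v) ->
  (forall t, g t != 0 -> exists u : 'cV[int]_n,
     t = cons_col (beta0 - sumv v - (sumv u)%:~R) (v + intv C u)) ->
  exists2 f, homogenization beta0 v f g &
    forall s, f s != 0 -> exists u, s = v + intv C u.
Proof.
move=> nint gsupp; set s0 := beta0 - sumv v.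
pose e (u : 'cV[int]_n) := cons_col (s0 - (sumv u)%:~R) (v + intv C u).
have /choice[f hf] : forall s, exists z, (forall u, s = v + intv C u ->
    g (e u) = dpow_coef s0 (sumv u) * z) /\ (z != 0 -> exists u, s = v + intv C u).
  move=> s; have [[u es]|nu] := pselect (exists u, s = v + intv C u); last first.
    by exists 0; split=> [u es|]; [case: nu; exists u|rewrite eqxx].
  exists (g (e u) / dpow_coef s0 (sumv u)); split=> [u'|_]; last by exists u.
  rewrite es => /addrI /intv_inj <-.
  by rewrite mulrCA mulfV ?mulr1 // dpow_coef_neq0.
exists f => [|s]; last by case: (hf s).
by split=> // u; have [h _] := hf (v + intv C u); exact: h.
Qed.

Variables (v : 'cV[C]_n) (f : series C n) (g : series C (1 + n)).
Hypothesis nint : ~ is_integer (beta0 - sumv v).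
Hypothesis hom : homogenization beta0 v f g.
Local Notation rv := (cons_col (beta0 - sumv v) v).

Lemma shift_rv (u : 'cV[int]_n) : rv + intv C (cons_col (- sumv u) u) =
  cons_col (beta0 - sumv v - (sumv u)%:~R) (v + intv C u).
Proof. by rewrite intv_cons cons_colD mulrNz. Qed.

Lemma homogenization_initial : g rv = f v.
Proof.
have [/(_ 0) + _] := hom; rewrite intv0 (_ : sumv 0 = 0); last first.
  by rewrite /sumv big1 // => i _; rewrite mxE.
by rewrite subr0 addr0 dpow_coef0 mul1r.
Qed.

Lemma nilsson_homogenize : weight_vector (rho_mx A) rbeta rw ->
  logfree_basic_nilsson A beta w v f ->
  logfree_basic_nilsson (rho_mx A) rbeta rw rv g.
Proof.
move=> [X0 [cX0 X0w _ X0I X0H]] [[sol [X [U [[cX Xw _ _ _] dU fsupp]]]] fv].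
split; last by rewrite homogenization_initial.
have fsupp' s : f s != 0 -> exists u, s = v + intv C u.
  by move=> /fsupp[u [_ es]]; exists u.
split; first exact/(homogenization_solution A beta nint fsupp' hom).
(* The cone from the weight vector of rho(A) keeps the initial ideals constant; the preimage of X
   keeps the shifted support in the dual cone. *)
exists [set W | X0 W /\ X (map_mx intr (dehom_mx n) *m W)].
exists [set cons_col (- sumv u) u | u in U]; split.
- split; first exact: cone_preimage.
  + by split=> //; rewrite dehom_mxE (_ : const_mx 0 = 0) ?subr0 //.
  + by left; exact: rho_ones.
  + by move=> W [/X0I].
  + by move=> W [/X0H].
- move=> _ [u /dU[du Au] <-]; split; last first.
    rewrite rho_mulZE addNr Au.
    by apply/esym/cons_colP => [|i]; rewrite !mxE.
  by move=> W [_ /du]; rewrite dotv_dehom.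
- move=> t /[dup] gt /hom.2[u et]; exists (cons_col (- sumv u) u).
  rewrite shift_rv; split=> //; exists u => //.
  have /fsupp[u' [Uu']] : f (v + intv C u) != 0.
    by move: gt; rewrite et hom.1 mulf_eq0 negb_or => /andP[].
  by move/addrI/intv_inj ->.
Qed.

Lemma nilsson_dehomogenize : weight_vector A beta w ->
  (forall s, f s != 0 -> exists u, s = v + intv C u) ->
  logfree_basic_nilsson (rho_mx A) rbeta rw rv g ->
  logfree_basic_nilsson A beta w v f.
Proof.
move=> [X1 [cX1 X1w X1pos X1I X1H]] fsupp.
move=> [[sol [X [U [[cX Xw _ _ _] dU gsupp]]]] gv].
split; last by rewrite -homogenization_initial.
split; first exact/(homogenization_solution A beta nint fsupp hom).
(* Symmetrically, X1 supplies constancy and positivity, while the preimage of X under w |-> (0, w)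
   controls the support. *)
exists [set w' | X1 w' /\ X (map_mx intr (incl_mx n) *m w')].
exists [set u | U (cons_col (- sumv u) u)]; split.
- split; first exact: cone_preimage.
  + by split=> //; rewrite incl_mxE.
  + case: X1pos => [|pos]; [by left|right].
    by move=> w' [/pos].
  + by move=> w' [/X1I].
  + by move=> w' [/X1H].
- move=> u /= /dU[du]; rewrite rho_mulZE => e; split.
    move=> w' [_ /du]; rewrite dotv_dehom incl_mxE dehom_mxE.
    by rewrite (_ : const_mx 0 = 0) ?subr0.
  apply/colP => i; have := congr1 (fun M : 'cV[int]_(1 + d) => M (rshift 1 i) 0) e.
  by rewrite /= cons_col_r !mxE.
- move=> s /[dup] fs /fsupp[u es]; exists u; split=> //=.
  have /gsupp[U' [UU' e]] : g (rv + intv C (cons_col (- sumv u) u)) != 0.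
    by rewrite shift_rv hom.1 mulf_neq0 ?dpow_coef_neq0 // -es.
  by move: e => /addrI/intv_inj ->.
Qed.

End HomogenizedNilsson.

(** * Spans of homogenizations *)

Section LinSpan.
Variables (F : pzRingType) (V : lmodType F) (G : set V).

Lemma lin_span_sub x : G x -> lin_span G x.
Proof.
move=> Gx; exists 1%N, (fun=> 1), (fun=> x); split=> //.
by rewrite big_ord1 scale1r.
Qed.

Lemma lin_span0 : lin_span G 0.
Proof.
exists 0%N, (fun=> 0), (fun=> 0); split; first by case.
by rewrite big_ord0.
Qed.

Lemma lin_span_scaleD c x y : lin_span G x -> lin_span G y -> lin_span G (c *: x + y).
Proof.
move=> [k [a [s [Gs ->]]]] [l [a' [s' [Gs' ->]]]].
pose g T' (f : 'I_k -> T') (f' : 'I_l -> T') (i : 'I_(k + l)) :=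
  match fintype.split i with inl j => f j | inr j => f' j end.
exists (k + l)%N, (g _ (fun i => c * a i) a'), (g _ s s'); split=> [i|].
  by rewrite /g; case: fintype.split.
rewrite big_split_ord /= scaler_sumr; congr (_ + _); apply: eq_bigr => i _; rewrite /g.
  by rewrite (unsplitK (inl i)) scalerA.
by rewrite (unsplitK (inr i)).
Qed.

Lemma lin_span_sum k (c : 'I_k -> F) (b : 'I_k -> V) :
  (forall i, lin_span G (b i)) -> lin_span G (\sum_i c i *: b i).
Proof.
move=> Gb; elim/big_rec: _ => [|i x _ Gx]; first exact: lin_span0.
exact: lin_span_scaleD.
Qed.

End LinSpan.

Section LinSpanImage.
Variables (F : pzRingType) (V W : lmodType F) (G : set V).
Variable f : V -> W.
Hypothesis f_linear : forall c x y, lin_span G x -> lin_span G y ->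
  f (c *: x + y) = c *: f x + f y.

Lemma linear_on_sum k (c : 'I_k -> F) (b : 'I_k -> V) :
  (forall i, lin_span G (b i)) -> f (\sum_i c i *: b i) = \sum_i c i *: f (b i).
Proof.
move=> Gb.
have f0 : f 0 = 0.
  have := f_linear (-1) (lin_span0 G) (lin_span0 G).
  by rewrite scaler0 add0r scaleN1r addNr.
have : lin_span G (\sum_i c i *: b i) /\ f (\sum_i c i *: b i) = \sum_i c i *: f (b i).
  elim/big_rec2: _ => [|i x y _ [Gy e]]; first by split=> //; exact: lin_span0.
  by split; [exact: lin_span_scaleD|rewrite f_linear // e].
by case.
Qed.

(** Linearity is available only on the span, so both inclusions are reduced to generators. *)
Lemma lin_span_image (H : set W) : (forall x, G x -> lin_span H (f x)) ->
  (forall y, H y -> exists2 x, lin_span G x & f x = y) ->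
  f @` lin_span G = lin_span H.
Proof.
move=> GH HG; apply/seteqP; split=> [_ [_ [k [c [b [Gb ->]]]] <-]|_ [k [c [h [Hh ->]]]]].
  rewrite linear_on_sum => [|i]; last exact: lin_span_sub.
  elim/big_rec: _ => [|i x _ Hx]; first exact: lin_span0.
  by apply: lin_span_scaleD; first exact: GH.
have /choice[x hx] : forall i, exists x, lin_span G x /\ f x = h i.
  by move=> i; have [x Gx fx] := HG _ (Hh i); exists x.
exists (\sum_i c i *: x i); first by apply: lin_span_sum => i; case: (hx i).
rewrite linear_on_sum => [|i]; last by case: (hx i).
by apply: eq_bigr => i _; case: (hx i) => _ ->.
Qed.

End LinSpanImage.

(** * Uniqueness, sums and change of base point *)

Section Rebase.
Variables (F : numFieldType) (n : nat) (beta0 : F) (v : 'cV[F]_n).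
Implicit Types (f : series F n) (g : series F (1 + n)).
Hypothesis nint : ~ is_integer (beta0 - sumv v).

Lemma homogenization_unique f g g' :
  homogenization beta0 v f g -> homogenization beta0 v f g' -> g = g'.
Proof.
move=> [gE gS] [gE' gS']; apply/funext => t.
have [gt|gt] := eqVneq (g t) 0; last by have [u ->] := gS _ gt; rewrite gE gE'.
have [->//|g't] := eqVneq (g' t) 0.
by have [u et] := gS' _ g't; rewrite et gE gE'.
Qed.

Lemma homogenization_sum k (c : 'I_k -> F) (b : 'I_k -> series F n)
    (h : 'I_k -> series F (1 + n)) :
  (forall i, homogenization beta0 v (b i) (h i)) ->
  homogenization beta0 v (\sum_i c i *: b i) (\sum_i c i *: h i).
Proof.
move=> hb; split=> [u|t].
  rewrite !fct_sumE mulr_sumr; apply: eq_bigr => i _.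
  by rewrite !fctE /GRing.scale /= (hb i).1 mulrCA.
rewrite fct_sumE => nz; apply: contrapT => nu; case/eqP: nz; apply: big1 => i _.
rewrite fctE /GRing.scale /=; have [->|/(hb i).2 //] := eqVneq (h i t) 0.
by rewrite mulr0.
Qed.

(** Moving the base point by u0 lowers beta0 - |v| by |u0|; additivity of [dpow_coef] turns this
    into one constant factor, the coefficient of d_0^|u0|. *)
Lemma homogenization_rebase u0 f g : homogenization beta0 (v + intv F u0) f g ->
  homogenization beta0 v f (dpow_coef (beta0 - sumv v) (sumv u0) *: g).
Proof.
have ev u : v + intv F u0 + intv F (u - u0) = v + intv F u.
  by rewrite -addrA -intvD [u0 + _]addrC subrK.
have es : beta0 - sumv (v + intv F u0) = beta0 - sumv v - (sumv u0)%:~R.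
  by rewrite sumvD sumv_intv opprD addrA.
have eu u : sumv u = sumv u0 + sumv (u - u0) by rewrite sumvD sumvN addrC subrK.
have e u : cons_col (beta0 - sumv v - (sumv u)%:~R) (v + intv F u) =
  cons_col (beta0 - sumv (v + intv F u0) - (sumv (u - u0))%:~R)
    (v + intv F u0 + intv F (u - u0)).
  by rewrite ev es [in LHS]eu intrD opprD addrA.
move=> [gE gS]; split=> [u|t].
  by rewrite fctE /GRing.scale /= e gE ev es mulrA -dpow_coefD // -eu.
rewrite fctE /GRing.scale /= mulf_eq0 negb_or => /andP[_ /gS[u ->]].
by exists (u0 + u); rewrite e [u0 + u]addrC addrK.
Qed.

End Rebase.

Theorem theorem5p5 (R : realType) (d n : nat) (A : 'M[int]_(d, n))
    (A_gen : columns_generate A)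
    (beta : 'cV[R[i]]_d) (w : 'cV[R]_n) (beta0 : R[i])
    (w_weight : weight_vector A beta w)
    (beta0_hom : homogenizing_value A beta w beta0)
    (w0_weight : weight_vector (rho_mx A) (cons_col beta0 beta) (cons_col 0 w))
    (B : set (series R[i] n))
    (B_basis : is_basis B (logfree_space A beta w))
    (B_nilsson : forall b, B b -> exists v, logfree_basic_nilsson A beta w v b)
    (rho : series R[i] n -> series R[i] (1 + n))
    (rho_linear : forall (c : R[i]) f g,
       logfree_space A beta w f -> logfree_space A beta w g ->
       rho (c *: f + g) = c *: rho f + rho g)
    (rho_basis : forall b v, B b -> logfree_basic_nilsson A beta w v b ->
       homogenization beta0 v b (rho b)) :
  rho @` logfree_space A beta w =
  lin_span [set psi | exists v alpha sigma,
    [/\ logfree_basic_nilsson (rho_mx A) (cons_col beta0 beta) (cons_col 0 w) v psi,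
        standard_pair (init_ideal (cons_col 0 w) (toric_ideal (rho_mx A)))
          alpha sigma,
        corresponds (rho_mx A) (cons_col beta0 beta) v alpha sigma &
        lshift n ord0 \in sigma]].
Proof.
have BS := B_basis.2; rewrite -BS in rho_linear *.
have nilsson_nint v f : logfree_basic_nilsson A beta w v f ->
    map_mx intr A *m v = beta /\ ~ is_integer (beta0 - sumv v).
  (* The starting exponent is a fake exponent, so the choice of beta0 gives nonintegrality. *)
  move=> nf; have [Av ann] := nilsson_annihilated nf.
  by split=> //; apply: beta0_hom.2; exact: fake_exponent_annihilated.
have supp_nilsson v f : logfree_basic_nilsson A beta w v f ->
    forall s, f s != 0 -> exists u, s = v + intv R[i] u.
  by move=> [[_ [X [U [_ _ fU]]]] _] s /fU[u [_ ->]]; exists u.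
apply: (lin_span_image rho_linear) => [b Bb|psi [v1 [alpha [sigma]]]].
  have [v nb] := B_nilsson _ Bb; have [Av nint] := nilsson_nint _ _ nb.
  have hom := rho_basis _ _ Bb nb.
  have nrb := nilsson_homogenize nint hom w0_weight nb.
  have [rAv ann] := nilsson_annihilated nrb.
  set J := init_ideal (cons_col 0 w) _ in ann.
  have Jid c (p : {mpoly R[i][1 + n]}) : J p -> J (c * p) by exact: ideal_genM.
  have Jann m : J 'X_[m] -> ff (cons_col (beta0 - sumv v) v) m = 0.
    by move/ann; apply; rewrite msuppX inE.
  have [alpha [sigma [sp av]]] := standard_pair_exists Jid Jann.
  apply: lin_span_sub; exists (cons_col (beta0 - sumv v) v), alpha, sigma; split=> //.
  (* If 0 were not in sigma, the x_0-coordinate beta0 - |v| would equal a natural number. *)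
  apply: contraT => /av; rewrite cons_col_l => e; case: nint.
  by rewrite e; exists (alpha (lshift n ord0)).
have [v0 [v ->]] : exists v0 v, v1 = cons_col v0 v.
  exists (v1 (lshift n ord0) 0), (dsubmx v1).
  by apply: cons_colP => [|i]; rewrite ?mxE.
move=> {v1} [npsi sp [rAv av] s0]; move: rAv; rewrite rho_mulE => /cons_col_inj[ev0 Av].
have [X [cX Xw _ XI _]] := w0_weight.
(* Passing through zero makes v a fake exponent of the original system, whence nonintegrality. *)
have ann := pass_zero_annihilated cX Xw XI sp av s0.
have nint : ~ is_integer (beta0 - sumv v).
  exact/beta0_hom.2/fake_exponent_annihilated.
(* The top Euler equation of rho(A) reads v0 + |v| = beta0. *)
have {}ev0 : v0 = beta0 - sumv v by rewrite -ev0 addrK.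
rewrite {}ev0 in npsi av.
have [f hom fsupp] : exists2 f, homogenization beta0 v f psi &
    forall s, f s != 0 -> exists u, s = v + intv R[i] u.
  apply: homogenization_exists => // t.
  case: npsi => [[_ [X' [U [_ dU psiU]]]] _] /psiU[u [/dU[_ /rho_ker[u' _ ->]] ->]].
  by exists u'; rewrite shift_rv.
have nf := nilsson_dehomogenize nint hom w_weight fsupp npsi.
have : logfree_space A beta w f.
  by apply: lin_span_sub; exists v; case: nf.
rewrite -BS => -[k [c [b [Bb ef]]]].
(* Express the homogenization of each basis element at the common base point v through [rho], which
   uses that element's own starting exponent. *)
have /choice[e he] : forall i, exists e, homogenization beta0 v (b i) (e *: rho (b i)).
  move=> i; have [vi nb] := B_nilsson _ (Bb i).
  have hb := rho_basis _ _ (Bb i) nb.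
  have [[u0 evi]|nu] := pselect (exists u0, vi = v + intv R[i] u0).
    by exists (dpow_coef (beta0 - sumv v) (sumv u0)); apply: homogenization_rebase; rewrite -?evi.
  (* Here b_i has no terms in v + Z^n, so its homogenization at v is zero. *)
  exists 0; rewrite scale0r; split=> [u|t]; last by rewrite eqxx.
  have [->|/(supp_nilsson _ _ nb)[u' eu]] := eqVneq (b i (v + intv R[i] u)) 0.
    by rewrite mulr0.
  case: nu; exists (u - u'); apply: (addIr (intv R[i] u')).
  by rewrite -eu -addrA -intvD subrK.
(* The preimage of psi need not be f: the coefficients of f are corrected by the rebasing factors
   e_i. *)
exists (\sum_i (c i * e i) *: b i).
  by apply: lin_span_sum => i; exact: lin_span_sub.
rewrite (linear_on_sum rho_linear) => [|i]; last exact: lin_span_sub.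
under eq_bigr do rewrite -scalerA.
by apply: (homogenization_unique _ hom); rewrite ef; apply: homogenization_sum.
Qed.
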